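(* Let $\chi$ be a probability distribution on $\mathbb{N}_0=\{0,1,2,\dots\}$ such that $\chi(\{i\})>0$ for every $i\in\mathbb{N}_0$ and whose expectation is greater than $1$. Let $\mu$ be the probability measure on the space $\mathcal{T}$ of rooted trees induced by the Galton-Watson branching process with offspring distribution $\chi$. Then finiteness of rooted trees is not almost expressible as an existential monadic second order sentence under $\mu$. That is, there do not exist a $\mu$-null set $\mathcal{T}_0$ of infinite trees and an EMSO $A$ such that every finite tree satisfies $A$ and every infinite tree in $\mathcal{T}\setminus\mathcal{T}_0$ satisfies the negation of $A$.
   Context: $\mathcal{T}$ is the space of all locally finite rooted trees (every node has finitely many children). Every tree $T$ has node set $V(T)$ and root $\phi$; $\pi(v)$ denotes the parent of a non-root node $v$. An existential monadic second order sentence (EMSO) on rooted trees is a sentence of the form $\exists S_1\cdots\exists S_n\,[P]$, where $n$ is a natural number, $S_1,\dots,S_n$ range over subsets of the set of nodes of the tree, and $P$ is a first-order sentence (quantifying over nodes) in the language with the root as a constant symbol, equality of nodes, the parent-child relation $\pi(v)=u$, and the membership relations $v\in S_i$. *)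

(* Defs.v *)
From HB Require Import structures.
From mathcomp Require Import all_boot all_order all_algebra.
From mathcomp Require Import all_classical all_reals all_analysis.

Set Implicit Arguments.
Unset Strict Implicit.
Unset Printing Implicit Defensive.
Import Order.TTheory GRing.Theory Num.Theory.

Local Open Scope classical_set_scope.

(* Locally finite rooted trees in Ulam-Harris-Neveu coding: the root is [::]   *)
(* and the children of v are i :: v for i smaller than the number of children  *)
(* of v. Addresses are thus listed from the node up to the root, and the       *)
(* parent of i :: v is v. Every locally finite rooted tree is isomorphic to    *)
(* one of this form.                                                           *)
Definition node := seq nat.

Record tree : Type := Tree {
  nodes : set node ;
  nodes_root : nodes [::] ;
  nodes_parent : forall i v, nodes (i :: v) -> nodes v ;
  nodes_children : forall v, nodes v ->
    exists k : nat, forall i : nat, nodes (i :: v) <-> (i < k)%N }.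

Definition finite_tree (T : tree) : Prop := finite_set (nodes T).

(* The tree in which each node v has c v children; the values of c outside the *)
(* tree are irrelevant.                                                        *)
Fixpoint offspring_nodes (c : node -> nat) (v : node) : Prop :=
  if v is i :: u then offspring_nodes c u /\ (i < c u)%N else True.

Program Definition offspring_tree (c : node -> nat) : tree :=
  @Tree (offspring_nodes c) I _ _.
Next Obligation. by move=> c i v []. Qed.
Next Obligation. by move=> c v vc; exists (c v) => i; split=> [[]|]. Qed.

HB.instance Definition _ := gen_eqMixin tree.
HB.instance Definition _ := gen_choiceMixin tree.
HB.instance Definition _ := isPointed.Build tree (offspring_tree (fun=> 0%N)).

Definition node_events : set (set tree) :=
  [set [set T | nodes T v] | v in [set: node]].

Definition tree_space := g_sigma_algebraType node_events.

Section GaltonWatson.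
Local Open Scope ereal_scope.
Context {R : realType}.

Definition iid_family (I : eqType) d (Omega : measurableType d)
    (P : probability Omega R) (chi : probability nat R)
    (X : I -> {RV P >-> nat}) : Prop :=
  (forall (i : I) (B : set nat), P (X i @^-1` B) = chi B) /\
  (forall (s : seq I) (B : I -> set nat), uniq s ->
     P (\bigcap_(i in [set` s]) (X i @^-1` B i)) =
     \prod_(i <- s) P (X i @^-1` B i)).

(* mu is the law of the random tree whose offspring numbers are i.i.d. chi. *)
Definition galton_watson_measure (chi : probability nat R)
    (mu : probability tree_space R) : Prop :=
  exists (d : measure_display) (Omega : measurableType d)
    (P : probability Omega R) (X : node -> {RV P >-> nat}),
    iid_family chi X /\
    forall A : set tree_space, measurable A ->
      mu A = P [set w | A (offspring_tree (fun v => X v w))].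

End GaltonWatson.

(* First-order formulas with n set symbols and m free node variables, in de    *)
(* Bruijn form: under a quantifier, variable 0 is the newly bound one.         *)
Inductive term (m : nat) : Type :=
| Root
| Var of 'I_m.
Arguments Root {m}.

Inductive formula (n : nat) : nat -> Type :=
| FEq m of term m & term m : formula n m
| FParent m of term m & term m : formula n m
| FMem m of term m & 'I_n : formula n m
| FNot m of formula n m : formula n m
| FAnd m of formula n m & formula n m : formula n m
| FOr m of formula n m & formula n m : formula n m
| FImp m of formula n m & formula n m : formula n m
| FForall m of formula n m.+1 : formula n m
| FExists m of formula n m.+1 : formula n m.

Definition extend_env m (e : 'I_m -> node) (x : node) : 'I_m.+1 -> node :=
  fun i => if unlift ord0 i is Some j then e j else x.

Definition eval_term m (e : 'I_m -> node) (t : term m) : node :=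
  match t with Root => [::] | Var i => e i end.

Definition is_parent (u v : node) : Prop := exists i : nat, v = i :: u.

(* FParent s t reads "the parent of s is t". *)
Fixpoint holds (T : tree) n (S : 'I_n -> set node) m (f : formula n m) :
    ('I_m -> node) -> Prop :=
  match f in formula _ m return ('I_m -> node) -> Prop with
  | FEq _ s t => fun e => eval_term e s = eval_term e t
  | FParent _ s t => fun e => is_parent (eval_term e t) (eval_term e s)
  | FMem _ t i => fun e => S i (eval_term e t)
  | FNot _ g => fun e => ~ holds T S g e
  | FAnd _ g h => fun e => holds T S g e /\ holds T S h e
  | FOr _ g h => fun e => holds T S g e \/ holds T S h e
  | FImp _ g h => fun e => holds T S g e -> holds T S h e
  | FForall _ g => fun e => forall x, nodes T x -> holds T S g (extend_env e x)
  | FExists _ g => fun e =>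
      exists2 x, nodes T x & holds T S g (extend_env e x)
  end.

Record emso : Type := Emso {
  emso_sets : nat ;
  emso_matrix : formula emso_sets 0 }.

Definition satisfies (T : tree) (A : emso) : Prop :=
  exists S : 'I_(emso_sets A) -> set node,
    (forall i, S i `<=` nodes T) /\
    holds T S (emso_matrix A) (fun=> [::]).

(* Main.v *)
Require Import Defs.
From HB Require Import structures.
From mathcomp Require Import all_boot all_order all_algebra.
From mathcomp Require Import all_classical all_reals all_analysis.
From mathcomp Require Import zify ring lra.

Set Implicit Arguments.
Unset Strict Implicit.
Unset Printing Implicit Defensive.
Import Order.TTheory GRing.Theory Num.Theory.

(** A sentence that holds in all finite trees cannot notice that one of many
equal branches of a finite tree has been replaced by an infinite tree, provided
that the infinite tree looks locally like the branch it replaces.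

Let the sentence hold in all finite trees, let k be the quantifier depth of its
first-order part, and let U be an infinite tree. For each h, consider the tree
whose root has N children, each carrying the truncation of U at height h. It is
finite, so some coloring witnesses the sentence. If N is large enough, more than
k of its N branches are colored in the same way ([equal_copies]). An ultrafilter
limit of these branch colorings, as h grows, is a coloring of U, every finite
part of which is copied from a truncation of arbitrarily large height
([limit_coloring]). Up to the threshold k there are finitely many local patterns
([words_finite]), so for one h every pattern of U occurs in the colored
truncation. Now put U in place of one of the equal branches. By a back-and-forth
argument ([similar_move], [holds_similar]) sentences of depth k do not change
their value. The root, its children and the other branches are answered by
themselves ([graft_core_of]); inside the equal branches, a move near earlier ones
is answered by copying the path that leads to it, and a move far from everything
by the same pattern in a copy of the truncation not touched so far. Hence for
each infinite U there are N, i and a finite tree Z such that the tree with N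
branches, U as the i-th and Z as all the others, satisfies the sentence
([replace_copy]).

If the infinite trees satisfying the sentence formed a null set, then by
independence of the branches, and since each finite tree Z has positive
probability, the trees U that work for a given triple N, i, Z would form a null
set ([branching], [graft_null]). There are countably many triples, so almost all
trees would be finite ([infinite_negligible]). This contradicts the survival of a
Galton-Watson process with mean offspring number above 1 ([survival]). *)

(** * Local types of nodes in a colored tree *)

Section LocalTypes.

Definition arity (T : tree) (v : node) : nat :=
  if pselect (nodes T v) is left Tv then projT1 (cid (nodes_children Tv)) else 0.

Lemma arityP (T : tree) v i : nodes T v -> (nodes T (i :: v) <-> i < arity T v).
Proof. by move=> Tv; rewrite /arity; case: pselect => // h; case: cid => k /= ->. Qed.

Lemma arity_unique (T : tree) v k :
  nodes T v -> (forall i, nodes T (i :: v) <-> i < k) -> arity T v = k.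
Proof.
move=> Tv Hk; have Ha i : (i < arity T v) = (i < k).
  by apply/idP/idP => [/(arityP i Tv)/Hk|/Hk/(arityP i Tv)].
by case: (ltngtP (arity T v) k) => // H; move: H;
  [rewrite -Ha|rewrite Ha]; rewrite ltnn.
Qed.

Record ctree (C : Type) := CTree { shape :> tree ; color : node -> C }.

Variables (C : finType) (q : nat).
Implicit Types (G : ctree C) (v : node).

(** A local type of depth [d.+1] records the type of depth [d] of the node and
how many children have each type of depth [d], counted up to the threshold [q].
The threshold keeps the set of types finite although degrees are unbounded. *)
Fixpoint ltype (d : nat) : finType :=
  if d is d'.+1 then (ltype d' * {ffun ltype d' -> 'I_q.+1})%type else C.

Fixpoint type_of d G v : ltype d :=
  match d return ltype d with
  | 0 => color G v
  | d'.+1 => (type_of d' G v,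
      [ffun t => inord (minn q (count (fun i => type_of d' G (i :: v) == t)
                                  (iota 0 (arity G v))))])
  end.

Lemma type_of_le d d' G G' v v' : d' <= d ->
  type_of d G v = type_of d G' v' -> type_of d' G v = type_of d' G' v'.
Proof.
elim: d => [|d IHd]; first by rewrite leqn0 => /eqP ->.
by rewrite leq_eqVlt => /orP[/eqP-> //|/IHd IH]; rewrite /= => -[/IH].
Qed.

Lemma type_of_color d G G' v v' :
  type_of d G v = type_of d G' v' -> color G v = color G' v'.
Proof. exact: (@type_of_le d 0). Qed.

Lemma type_of_count d G G' v v' t : type_of d.+1 G v = type_of d.+1 G' v' ->
  minn q (count (fun i => type_of d G (i :: v) == t) (iota 0 (arity G v))) =
  minn q (count (fun i => type_of d G' (i :: v') == t) (iota 0 (arity G' v'))).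
Proof.
case=> _ /ffunP/(_ t); rewrite !ffunE => /(congr1 val).
by rewrite /= !inordK ?ltnS ?geq_minl.
Qed.

(** A local type of depth [d] depends only on the [d] generations below the
node. *)
Lemma type_of_agree d G G' v v' : nodes G v -> nodes G' v' ->
  (forall s, size s <= d -> (nodes G (s ++ v) <-> nodes G' (s ++ v'))) ->
  (forall s, size s <= d -> nodes G (s ++ v) ->
     color G (s ++ v) = color G' (s ++ v')) ->
  type_of d G v = type_of d G' v'.
Proof.
elim: d v v' => [|d IHd] v v' Gv Gv' Hn Hc; first exact: (Hc [::]).
have Hch i : nodes G (i :: v) <-> nodes G' (i :: v') by exact: (Hn [:: i]).
have IH w w' : (w, w') = (v, v') \/
      (exists i, [/\ w = i :: v, w' = i :: v' & nodes G w]) ->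
    type_of d G w = type_of d G' w'.
  case=> [[-> ->]|[i [-> -> Gi]]].
    by apply: IHd => // s Hs; [apply: Hn|apply: Hc]; exact: leqW.
  apply: IHd => //; [exact/Hch|move=> s Hs|move=> s Hs]; rewrite -!cat_rcons;
    by [apply: Hn; rewrite size_rcons|apply: Hc; rewrite size_rcons].
rewrite /=; congr pair; first by apply: IH; left.
apply/ffunP => t; rewrite !ffunE; congr (inord (minn _ _)).
have -> : arity G v = arity G' v'.
  by apply: arity_unique => // i; rewrite Hch; exact: arityP.
apply: eq_in_count => i; rewrite mem_iota add0n => /andP[_ Hi].
by rewrite (@IH (i :: v) (i :: v')) //; right; exists i; split => //; apply/Hch/arityP.
Qed.

Lemma type_of_child d G G' v v' i : 0 < q -> nodes G v -> nodes G' v' ->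
  type_of d.+1 G v = type_of d.+1 G' v' -> nodes G (i :: v) ->
  exists2 i', nodes G' (i' :: v') & type_of d G (i :: v) = type_of d G' (i' :: v').
Proof.
move=> q0 Gv Gv' /(type_of_count (type_of d G (i :: v))) Ht Gi.
have : has (fun j => type_of d G' (j :: v') == type_of d G (i :: v))
    (iota 0 (arity G' v')).
  rewrite has_count.
  have : 0 < count (fun j => type_of d G (j :: v) == type_of d G (i :: v))
      (iota 0 (arity G v)).
    rewrite -has_count; apply/hasP; exists i => //.
    by rewrite mem_iota add0n; exact/arityP.
  by move: Ht; lia.
case/hasP => j; rewrite mem_iota add0n => /andP[_ Hj] /eqP Hji.
by exists j; [apply/arityP|].
Qed.

End LocalTypes.

(** * The back-and-forth game *)

(** This finds the answer to a move from a node to one of its children. Here [s]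
and [s'] list the children of two nodes with the same local type, [p] and [p']
select those of one given type, and [b], [b'] those already matched; [rho j k l]
says that the [k]-th played pair lies below [l] on one side and [j] on the other.
There are fewer played pairs than the threshold, so a child that is not yet
matched on one side forces one on the other. *)
Lemma count_avoid q m (s s' : seq nat) (p p' b b' : pred nat)
    (rho : nat -> nat -> nat -> Prop) i :
  uniq s' -> m < q ->
  minn q (count p s) = minn q (count p' s') ->
  (forall j, j \in s' -> p' j -> b' j ->
     exists k l, [/\ k < m, l \in s, p l, b l & rho j k l]) ->
  (forall j1 j2 k l1 l2, rho j1 k l1 -> rho j2 k l2 -> j1 = j2) ->
  (forall j1 j2 k1 k2 l, rho j1 k1 l -> rho j2 k2 l -> j1 = j2) ->
  i \in s -> p i -> ~~ b i ->
  exists j, [/\ j \in s', p' j & ~~ b' j].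
Proof.
move=> us' mq Hmin Hrho Hk Hl si pi bi; apply: contrapT => Hno.
have Hb j : j \in s' -> p' j -> b' j.
  by move=> js pj; case: (boolP (b' j)) => // nb; case: Hno; exists j.
have /choice[g Hg] : forall j, exists kl : nat * nat, j \in s' -> p' j ->
    [/\ kl.1 < m, kl.2 \in s, p kl.2, b kl.2 & rho j kl.1 kl.2].
  move=> j; case: (boolP (j \in s')) => [js|]; last by exists (0, 0).
  case: (boolP (p' j)) => [pj|]; last by exists (0, 0).
  by have [k [l H]] := Hrho j js pj (Hb j js pj); exists (k, l).
set L' := [seq j <- s' | p' j]; set L := [seq j <- s | p j].
have uL' : uniq L' by exact: filter_uniq.
have Hm : size L' <= m.
  rewrite -(size_map (fun j => (g j).1)) -[leqRHS](size_iota 0).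
  apply: uniq_leq_size.
    rewrite map_inj_in_uniq // => j1 j2; rewrite !mem_filter.
    move=> /andP[p1 s1] /andP[p2 s2] E.
    have [_ _ _ _ r1] := Hg _ s1 p1; have [_ _ _ _ r2] := Hg _ s2 p2.
    by apply: Hk r1 _; rewrite E; exact: r2.
  move=> _ /mapP[j + ->]; rewrite mem_filter mem_iota => /andP[pj sj].
  by have [] := Hg _ sj pj.
have iL : i \in L by rewrite mem_filter pi.
have Hs : size L' < size L.
  have : size (map (fun j => (g j).2) L') <= size (rem i L).
    apply: uniq_leq_size.
      rewrite map_inj_in_uniq // => j1 j2; rewrite !mem_filter.
      move=> /andP[p1 s1] /andP[p2 s2] E.
      have [_ _ _ _ r1] := Hg _ s1 p1; have [_ _ _ _ r2] := Hg _ s2 p2.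
      by apply: Hl r1 _; rewrite E; exact: r2.
    move=> _ /mapP[j + ->]; rewrite mem_filter => /andP[pj sj].
    have [_ gs gp gb _] := Hg _ sj pj.
    have : (g j).2 \in L by rewrite mem_filter gp.
    rewrite (perm_mem (perm_to_rem iL)).
    by rewrite inE => /orP[/eqP E|//]; move: bi; rewrite -E gb.
  by rewrite size_map size_rem //; case: (L) iL => //= ? ? _; lia.
by move: Hmin Hm Hs; rewrite -!size_filter -/L -/L'; lia.
Qed.

Section Matching.
Variables (C : finType) (q : nat).
Implicit Types (G : ctree C) (K : set node).

(** The matched pairs of a position: the nodes of a common part [K], and the
ancestors at distance at most [r] of the nodes played so far. Addresses list a
node from itself up to the root, so [drop c] is the [c]-fold parent. *)
Definition matched K m (e e' : 'I_m -> node) r (x x' : node) : Prop :=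
  (K x /\ x = x') \/
  exists k c, [/\ c <= r, x = drop c (e k) & x' = drop c (e' k)].

(** A position is good for radius [r] and depth [d] if the matched pairs form a
partial bijection that preserves the local types of depth [d]. *)
Record similar G G' K r d m (e e' : 'I_m -> node) : Prop := Similar {
  sim_nodes : forall k, nodes G (e k) ;
  sim_nodes' : forall k, nodes G' (e' k) ;
  sim_inj : forall x x' y y', matched K e e' r x x' -> matched K e e' r y y' ->
    (x = y <-> x' = y') ;
  sim_type : forall x x', matched K e e' r x x' ->
    type_of q d G x = type_of q d G' x' }.

(** The answer to a move far below [K]: a node whose [r] nearest ancestors have
the same local types, and avoid both [K] and the neighborhoods of the nodes
already played. *)
Definition far_extends G G' K r0 d0 : Prop :=
  forall r m (e' : 'I_m -> node) b, r <= r0 -> m < q -> nodes G b ->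
    (forall a, a <= r -> ~ K (drop a b)) ->
    exists b', [/\ nodes G' b', forall a, a <= r -> ~ K (drop a b'),
      forall a, a <= r -> type_of q d0 G (drop a b) = type_of q d0 G' (drop a b') &
      forall a k c, a <= r -> c <= r -> drop a b' <> drop c (e' k)].

(** Conditions under which it is safe to answer each node of [K] by itself. If
one child of a node is in [K], then all its children are, so that children have
to be matched by counting only where no child is in [K]. *)
Record core_of G G' K r0 d0 : Prop := CoreOf {
  core_root : K [::] ;
  core_parent : forall i v, K (i :: v) -> K v ;
  core_sibling : forall i j v, K (i :: v) -> nodes G (j :: v) -> K (j :: v) ;
  core_sibling' : forall i j v, K (i :: v) -> nodes G' (j :: v) -> K (j :: v) ;
  core_nodes : forall v, K v -> nodes G v ;
  core_nodes' : forall v, K v -> nodes G' v ;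
  core_type : forall v, K v -> type_of q d0 G v = type_of q d0 G' v ;
  core_far : far_extends G G' K r0 d0 ;
  core_far' : far_extends G' G K r0 d0 }.

Lemma core_sym G G' K r0 d0 : core_of G G' K r0 d0 -> core_of G' G K r0 d0.
Proof. by case=> ? ? ? ? ? ? t ? ?; split=> // v /t. Qed.

Lemma matched_sym K m (e e' : 'I_m -> node) r x x' :
  matched K e e' r x x' <-> matched K e' e r x' x.
Proof.
have H f f' y y' : matched K f f' r y y' -> matched K f' f r y' y.
  by case=> [[Ky <-]|[k [c [cr -> ->]]]]; [left|right; exists k, c].
by split; exact: H.
Qed.

Lemma similar_sym G G' K r d m (e e' : 'I_m -> node) :
  similar G G' K r d e e' -> similar G' G K r d e' e.
Proof.
case=> n n' i t; split=> //.
  by move=> x x' y y' /matched_sym xx' /matched_sym yy'; split=> /(i _ _ _ _ xx' yy').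
by move=> x x' /matched_sym/t ->.
Qed.

Lemma matched_le K m (e e' : 'I_m -> node) r r' x x' :
  r <= r' -> matched K e e' r x x' -> matched K e e' r' x x'.
Proof.
move=> rr' [H|[k [c [cr -> ->]]]]; first by left.
by right; exists k, c; split=> //; exact: leq_trans rr'.
Qed.

Lemma nodes_drop (T : tree) a v : nodes T v -> nodes T (drop a v).
Proof.
elim: a v => [|a IHa] [|i v] //= Tv; apply: IHa; exact: nodes_parent Tv.
Qed.

Lemma drop_size_inj (a b : nat) (v : node) :
  0 < size (drop a v) -> size (drop a v) = size (drop b v) -> a = b.
Proof. by rewrite !size_drop; lia. Qed.

Section Moves.
Variables (G G' : ctree C) (K : set node) (r0 d0 : nat).
Hypothesis core : core_of G G' K r0 d0.
Variables (m : nat) (e e' : 'I_m -> node).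

Lemma matched_drop a r x x' : matched K e e' r x x' ->
  matched K e e' (r + a) (drop a x) (drop a x').
Proof.
case=> [[Kx <-]|[k [c [cr -> ->]]]].
  left; split=> //; elim: a x Kx => [|a IHa] [|i v] //= Kx.
  exact: IHa (core_parent core Kx).
by right; exists k, (c + a); rewrite !drop_drop ![a + c]addnC leq_add2r.
Qed.

Lemma matched_behead r x x' : matched K e e' r x x' ->
  matched K e e' r.+1 (behead x) (behead x').
Proof. by rewrite -addn1 -!drop1; exact: matched_drop. Qed.

Lemma matched_nodes r d x x' : similar G G' K r d e e' ->
  matched K e e' r x x' -> nodes G x /\ nodes G' x'.
Proof.
move=> S [[Kx <-]|[k [c [cr -> ->]]]].
  by split; [exact: core_nodes core _ Kx|exact: core_nodes' core _ Kx].
by split; apply: nodes_drop; [exact: sim_nodes S _|exact: sim_nodes' S _].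
Qed.

(** The extra unit of radius makes the parents of matched nodes matched too, so
that matched children of [x'] come from matched children of [x]. *)
Lemma child_match r d x x' i : m < q -> similar G G' K r.+1 d.+1 e e' ->
  matched K e e' r x x' -> nodes G (i :: x) ->
  (forall y', ~ matched K e e' r (i :: x) y') ->
  exists i', [/\ nodes G' (i' :: x'),
    forall y, ~ matched K e e' r y (i' :: x') &
    type_of q d G (i :: x) = type_of q d G' (i' :: x')].
Proof.
move=> mq S xx' Gi ni; have xx'1 := matched_le (leqnSn r) xx'.
have [Gx Gx'] := matched_nodes S xx'1.
have [injS tyS] := (sim_inj S, sim_type S).
have nK j : nodes G' (j :: x') -> ~ K (j :: x').
  move=> Gj Kj; have Kx' := core_parent core Kj.
  have Ex : x = x'.
    by apply/(injS _ _ _ _ xx'1 (_ : matched _ _ _ _ x' x')) => //; left.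
  apply: (ni (i :: x)); left; split=> //.
  by rewrite Ex in Gi *; exact: core_sibling core _ _ _ Kj Gi.
pose rho j (k : nat) l := exists (k' : 'I_m) c, [/\ k = k', c <= r,
  l :: x = drop c (e k') & j :: x' = drop c (e' k')].
have rhoM j k l : rho j k l -> matched K e e' r (l :: x) (j :: x').
  by case=> k' [c [_ cr -> ->]]; right; exists k', c.
pose p j := type_of q d G (j :: x) == type_of q d G (i :: x).
pose p' j := type_of q d G' (j :: x') == type_of q d G (i :: x).
pose b j := `[< exists y', matched K e e' r (j :: x) y' >].
pose b' j := `[< exists y, matched K e e' r y (j :: x') >].
have := @count_avoid q m (iota 0 (arity G x)) (iota 0 (arity G' x')) p p' b b' rho i.
case=> //.
- exact: iota_uniq.
- by apply: type_of_count; apply: tyS.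
- move=> j; rewrite mem_iota add0n => /= jA pj /asboolP[y yj].
  have Gj : nodes G' (j :: x') by apply/arityP.
  case: (yj) => [[Ky Ey]|[k [c [cr Ey Ej]]]]; first by case: (nK j Gj); rewrite -Ey.
  have Ex : behead y = x.
    apply/(injS _ _ _ _ _ xx'1); last reflexivity.
    exact: matched_behead yj.
  case: y yj Ey Ex => [|l z] yj Ey.
    have rr : matched K e e' r.+1 [::] [::] by left; split=> //; exact: core_root core.
    by have [/(_ erefl)] := injS _ _ _ _ (matched_le (leqnSn r) yj) rr.
  move=> /= Ez; rewrite Ez in yj Ey.
  exists k, l; split=> //.
  + rewrite mem_iota add0n; apply/arityP => //.
    by rewrite Ey; exact/nodes_drop/(sim_nodes S).
  + have /(type_of_le (leqnSn d)) Hl := tyS _ _ (matched_le (leqnSn r) yj).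
    by rewrite /p Hl.
  + by apply/asboolP; exists (j :: x').
  + by exists k, c.
- move=> j1 j2 k l1 l2 [k1 [c1 [-> _ _ E1]]] [k2 [c2 [/val_inj <- _ _ E2]]].
  have Ec : c1 = c2 by apply: (@drop_size_inj _ _ (e' k1)); rewrite -E1 // -E2.
  by move: E1; rewrite Ec -E2 => -[].
- move=> j1 j2 k1 k2 l /rhoM/(matched_le (leqnSn r)) H1.
  move=> /rhoM/(matched_le (leqnSn r)) H2.
  by have [/(_ erefl) [->]] := injS _ _ _ _ H1 H2.
- by rewrite mem_iota add0n; exact/arityP.
- by rewrite /p eqxx.
- by apply/asboolP => -[y /ni].
move=> j; rewrite mem_iota add0n => -[/= jA /eqP pj /asboolP bj].
by exists j; split=> //; [apply/arityP|move=> y yj; apply: bj; exists y].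
Qed.

(** A path leaving the matched nodes is copied step by step. Only the first step
needs [child_match]: a later node cannot be matched at a smaller radius, since
its parent would then be matched at the previous radius. *)
Lemma path_match R d x x' s : m < q -> similar G G' K R.+1 d e e' ->
  matched K e e' R x x' -> size s <= R -> size s <= d -> nodes G (s ++ x) ->
  (forall a y', a < size s -> ~ matched K e e' R (drop a (s ++ x)) y') ->
  exists s', [/\ size s' = size s, nodes G' (s' ++ x'),
    forall a y, a < size s -> ~ matched K e e' (R - size s) y (drop a (s' ++ x')) &
    forall a, a <= size s -> type_of q (d - size s) G (drop a (s ++ x)) =
                             type_of q (d - size s) G' (drop a (s' ++ x'))].
Proof.
move=> mq S xx'; have xx'1 := matched_le (leqnSn R) xx'.
have [Gx Gx'] := matched_nodes S xx'1.
elim: s => [|i t IHt] /= tR td Gt nt.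
  exists [::]; split=> // a; rewrite leqn0 => /eqP->; rewrite subn0 !drop0.
  exact: sim_type S _ _ xx'1.
have Gy : nodes G (t ++ x) by exact: nodes_parent Gt.
have [t' [st' Gt' nt' tt']] := IHt (ltnW tR) (ltnW td) Gy (fun a y' => nt a.+1 y').
have ty0 := tt' 0 (leq0n _); rewrite !drop0 in ty0.
have Ed : d - size t = (d - (size t).+1).+1 by lia.
rewrite Ed in ty0.
have [i' [Gi' ni' tyi']] : exists i', [/\ nodes G' (i' :: t' ++ x'),
    forall y, ~ matched K e e' (R - (size t).+1) y (i' :: t' ++ x') &
    type_of q (d - (size t).+1) G (i :: t ++ x) =
    type_of q (d - (size t).+1) G' (i' :: t' ++ x')].
  case: (posnP (size t)) => [t0|t0].
    move: t0 st' Ed ty0 Gt nt tR => /[dup] /size0nil -> /= _ /size0nil -> Ed ty0 Gt nt tR.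
    have Hd : d = (d - 1).+1 by lia.
    have S' := S; rewrite Hd in S'.
    have [i' [H1 H2 H3]] := child_match mq S' xx' Gt (fun y' => nt 0 y' isT).
    exists i'; split=> // y; apply: contra_not (H2 y); apply: matched_le; lia.
  have [i' H1 H2] := type_of_child (leq_ltn_trans (leq0n m) mq) Gy Gt' ty0 Gt.
  exists i'; split=> // y /matched_behead/= Hy.
  apply: (nt' 0 (behead y) t0); rewrite drop0; move: Hy; apply: matched_le; lia.
exists (i' :: t'); split=> //=; first by rewrite st'.
- move=> [|a] y // al Hy; apply: (nt' a y); first by lia.
  by move: Hy; apply: matched_le; lia.
- move=> [|a] // al; apply: type_of_le (tt' a _); lia.
Qed.

Lemma matched_extend b b' r y y' :
  matched K (extend_env e b) (extend_env e' b') r y y' ->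
  matched K e e' r y y' \/
  exists c, [/\ c <= r, y = drop c b & y' = drop c b'].
Proof.
case=> [|[k [c [cr]]]]; first by left; left.
rewrite /extend_env; case: unliftP => [j _|_] -> ->.
  by left; right; exists j, c.
by right; exists c.
Qed.

(** The path from the new node [b] up to the root leaves the new territory after
[a] steps. Below that point nothing was matched before on either side, and from
there on the pairs were matched already at a larger radius. *)
Lemma similar_extend r a d b b' :
  similar G G' K (3 * r).+1 d e e' -> nodes G b -> nodes G' b' ->
  a <= size b -> a <= size b' ->
  (forall c, c <= r -> a <= c -> matched K e e' (3 * r).+1 (drop c b) (drop c b')) ->
  (forall c y', c <= r -> c < a -> ~ matched K e e' r (drop c b) y') ->
  (forall c y, c <= r -> c < a -> ~ matched K e e' r y (drop c b')) ->
  (forall c, c <= r -> c < a ->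
     type_of q d G (drop c b) = type_of q d G' (drop c b')) ->
  similar G G' K r d (extend_env e b) (extend_env e' b').
Proof.
move=> S Gb Gb' ab ab' old new new' ty.
have r3 : r <= (3 * r).+1 by lia.
have new_ y y' : matched K (extend_env e b) (extend_env e' b') r y y' ->
    matched K e e' (3 * r).+1 y y' \/
    exists c, [/\ c <= r, c < a, y = drop c b & y' = drop c b'].
  case/matched_extend => [yy'|[c [cr -> ->]]]; first by left; exact: matched_le yy'.
  by case: (leqP a c) => ac; [left; apply: old|right; exists c].
have drop_neq c1 c2 (v : node) :
    c1 < a -> a <= size v -> c1 < c2 -> drop c1 v <> drop c2 v.
  by move=> c1a av c12 E; have := congr1 size E; rewrite !size_drop; lia.
have drop_eq c1 c2 : c1 < a -> (drop c1 b = drop c2 b <-> drop c1 b' = drop c2 b').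
  move=> c1a; case: (ltngtP c1 c2) => [H|H|-> //].
    by split=> E; [case: (drop_neq _ _ _ c1a ab H)|case: (drop_neq _ _ _ c1a ab' H)].
  have c2a := ltn_trans H c1a.
  by split=> /esym E; [case: (drop_neq _ _ _ c2a ab H)|case: (drop_neq _ _ _ c2a ab' H)].
have cross c x x' : c <= r -> c < a ->
    matched K (extend_env e b) (extend_env e' b') r x x' ->
    (x = drop c b <-> x' = drop c b').
  move=> cr ca /matched_extend[xx'|[c2 [c2r -> ->]]].
    split=> E; first by case: (new c x' cr ca); rewrite -E.
    by case: (new' c x cr ca); rewrite -E.
  by split=> /esym/(drop_eq _ _ ca)/esym.
split.
- move=> k; rewrite /extend_env; case: unlift => // j; exact: sim_nodes S _.
- move=> k; rewrite /extend_env; case: unlift => // j; exact: sim_nodes' S _.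
- move=> x x' y y' xx' yy'.
  have [yy'o|[c [cr ca -> ->]]] := new_ _ _ yy'; last exact: cross.
  have [xx'o|[c [cr ca -> ->]]] := new_ _ _ xx'.
    exact: sim_inj S _ _ _ _ xx'o yy'o.
  by split=> /esym/(cross c _ _ cr ca yy')/esym.
- by move=> x x' /new_[/(sim_type S)//|[c [cr ca -> ->]]]; exact: ty.
Qed.

(** If [b] has an ancestor within [r] steps that is matched at radius [2 * r],
the path from the lowest such ancestor to [b] is copied by [path_match], which
uses up at most [r] of the radius and [r] of the depth; above this ancestor the
neighborhood of [b] is matched at radius [3 * r]. Otherwise [b] is far from
everything, and [core_far] gives the answer. *)
Lemma similar_move r d b : m < q -> r <= r0 -> d <= d0 ->
  similar G G' K (3 * r).+1 (d + r) e e' -> nodes G b ->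
  exists2 b', nodes G' b' &
    similar G G' K r d (extend_env e b) (extend_env e' b').
Proof.
move=> mq rr0 dd0 S Gb.
have S' : similar G G' K (3 * r).+1 d e e'.
  case: S => n n' inj ty; split=> // x x' /ty; apply: type_of_le; exact: leq_addr.
have [near|far] := EM (exists a, a <= r /\
    exists x', matched K e e' (2 * r) (drop a b) x').
  have exa : exists a, `[< a <= r /\ exists x', matched K e e' (2 * r) (drop a b) x' >].
    by case: near => a Ha; exists a; exact/asboolP.
  case: (ex_minnP exa) => a /asboolP[ar [x' xx']] amin.
  have ab : a <= size b.
    rewrite leqNgt; apply/negP => ba.
    suff : a <= size b by rewrite leqNgt ba.
    apply: amin; apply/asboolP; split; first exact: leq_trans (ltnW ba) ar.
    exists x'; rewrite drop_size.
    by move: xx'; rewrite drop_oversize // ltnW.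
  have sa : size (take a b) = a by rewrite size_takel.
  have dab c : drop c b = drop c (take a b ++ drop a b) by rewrite cat_take_drop.
  have [|||||t [st Gt nt tt]] :=
    @path_match (2 * r) (d + r) (drop a b) x' (take a b) mq _ xx'.
  - case: S => n n' inj ty; split=> //.
      move=> x z y y' xz yy'; apply: inj; [move: xz|move: yy']; apply: matched_le; lia.
    move=> x z xz; apply: ty; move: xz; apply: matched_le; lia.
  - by rewrite sa; lia.
  - by rewrite sa; lia.
  - by rewrite cat_take_drop.
  - move=> c y'; rewrite sa cat_take_drop => ca Hc.
    suff : a <= c by rewrite leqNgt ca.
    apply: amin; apply/asboolP; split; first exact: leq_trans (ltnW ca) ar.
    by exists y'.
  rewrite sa in st nt tt; exists (t ++ x') => //.
  apply: (@similar_extend r a) => //.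
  - by rewrite size_cat st leq_addr.
  - move=> c cr ac; have -> : drop c (t ++ x') = drop (c - a) x'.
      by rewrite drop_cat st ltnNge ac.
    have -> : drop c b = drop (c - a) (drop a b) by rewrite drop_drop subnK.
    move: (matched_drop (c - a) xx'); apply: matched_le; lia.
  - move=> c y' cr ca Hc; suff : a <= c by rewrite leqNgt ca.
    apply: amin; apply/asboolP; split=> //; exists y'.
    by move: Hc; apply: matched_le; lia.
  - move=> c y cr ca Hc; apply: (nt c y ca); move: Hc; apply: matched_le; lia.
  - move=> c cr ca; have := tt c (ltnW ca); rewrite cat_take_drop.
    by apply: type_of_le; lia.
have nKb a : a <= r -> ~ K (drop a b).
  by move=> ar Ka; apply: far; exists a; split=> //; exists (drop a b); left.
have [b' [Gb' nKb' tb' db']] := core_far core e' rr0 mq Gb nKb.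
have big (v : node) : (forall a, a <= r -> ~ K (drop a v)) -> r < size v.
  move=> nKv; rewrite ltnNge; apply/negP => vr.
  by apply: (nKv (size v) vr); rewrite drop_size; exact: core_root core.
exists b' => //; apply: (@similar_extend r r.+1) => //.
- exact: big.
- exact: big.
- by move=> c cr; rewrite ltnNge cr.
- move=> c y' cr _ Hc; apply: far; exists c; split=> //; exists y'.
  by move: Hc; apply: matched_le; lia.
- move=> c y cr _ [[Ky Ey]|[k [a [ar _]]]]; last exact: db'.
  by apply: (nKb' c cr); rewrite -Ey.
- by move=> c cr _; apply: type_of_le (tb' c cr).
Qed.

End Moves.
End Matching.

(** * First-order sentences cannot leave the game *)

Section FirstOrder.

Fixpoint qdepth n m (f : formula n m) : nat :=
  match f with
  | FEq _ _ _ | FParent _ _ _ | FMem _ _ _ => 0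
  | FNot _ g => qdepth g
  | FAnd _ g h | FOr _ g h | FImp _ g h => maxn (qdepth g) (qdepth h)
  | FForall _ g | FExists _ g => (qdepth g).+1
  end.

(** The radius and depth that suffice for [j] more moves, as consumed by
[similar_move]. Radius 1 is kept at the end for the atomic formula on parents. *)
Fixpoint game_radius j := if j is j'.+1 then (3 * game_radius j').+1 else 1.
Fixpoint game_depth j := if j is j'.+1 then game_depth j' + game_radius j' else 0.

Lemma game_radius_le j k : j <= k -> game_radius j <= game_radius k.
Proof.
elim: k => [|k IHk]; first by rewrite leqn0 => /eqP->.
rewrite leq_eqVlt => /orP[/eqP-> //|/IHk /=]; lia.
Qed.

Lemma game_depth_le j k : j <= k -> game_depth j <= game_depth k.
Proof.
elim: k => [|k IHk]; first by rewrite leqn0 => /eqP->.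
rewrite leq_eqVlt => /orP[/eqP-> //|/IHk /=]; lia.
Qed.

Definition colors_of n (S : 'I_n -> set node) (v : node) : {set 'I_n} :=
  [set i | `[< S i v >]].

Variables (n k : nat) (T T' : tree) (S S' : 'I_n -> set node) (K : set node).
Let G := CTree T (colors_of S).
Let G' := CTree T' (colors_of S').
Hypothesis core : core_of k G G' K (game_radius k) (game_depth k).

Lemma matched_term r m (e e' : 'I_m -> node) (t : term m) :
  matched K e e' r (eval_term e t) (eval_term e' t).
Proof.
case: t => [|i] /=; first by left; split=> //; exact: core_root core.
by right; exists i, 0; rewrite !drop0.
Qed.

Lemma is_parentE u v : is_parent u v <-> v <> [::] /\ behead v = u.
Proof. by split=> [[i ->]//|]; case: v => [|i v] [] // _ /= ->; exists i. Qed.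

(** The game for the threshold [k] answers up to [k] moves: [m] of them have been
played and [j] remain. *)
Lemma holds_similar m (f : formula n m) j (e e' : 'I_m -> node) :
  qdepth f <= j -> m + j <= k ->
  similar k G G' K (game_radius j) (game_depth j) e e' ->
  (holds T S f e <-> holds T' S' f e').
Proof.
elim: f j e e' => /= {m} [m s t|m s t|m t i|m g IHg|m g IHg h IHh|m g IHg h IHh|
  m g IHg h IHh|m g IHg|m g IHg] j e e'.
- by move=> _ _ Sim; apply: (sim_inj Sim); exact: matched_term.
- move=> _ _ Sim; rewrite !is_parentE.
  have r1 : 1 <= game_radius j by exact: (game_radius_le (leq0n j)).
  have Hs := matched_term (game_radius j) e e' s.
  have Ht := matched_term (game_radius j) e e' t.
  have H0 := matched_term (game_radius j) e e' Root.
  have E1 := sim_inj Sim Hs H0; rewrite /= in E1.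
  have Hb := matched_le r1 (matched_behead core (matched_term 0 e e' s)).
  have E2 := sim_inj Sim Hb Ht.
  by tauto.
- move=> _ _ Sim.
  have := type_of_color (sim_type Sim (matched_term (game_radius j) e e' t)).
  move=> /setP/(_ i); rewrite /= !inE; exact: asbool_eq_equiv.
- by move=> gj mk Sim; have := IHg j e e' gj mk Sim; tauto.
- rewrite geq_max => /andP[gj hj] mk Sim.
  by have := IHg j e e' gj mk Sim; have := IHh j e e' hj mk Sim; tauto.
- rewrite geq_max => /andP[gj hj] mk Sim.
  by have := IHg j e e' gj mk Sim; have := IHh j e e' hj mk Sim; tauto.
- rewrite geq_max => /andP[gj hj] mk Sim.
  by have := IHg j e e' gj mk Sim; have := IHh j e e' hj mk Sim; tauto.
- case: j => // j gj mk Sim.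
  have jk : j <= k by lia.
  have mk' : m < k by lia.
  have mk1 : m.+1 + j <= k by rewrite addSnnS.
  split=> H x Tx.
    have [y Ty Sy] :=
        similar_move (core_sym core) mk' (game_radius_le jk) (game_depth_le jk)
          (similar_sym Sim) Tx.
    exact/(IHg j _ _ gj mk1 (similar_sym Sy))/H.
  have [y Ty Sy] :=
        similar_move core mk' (game_radius_le jk) (game_depth_le jk) Sim Tx.
  exact/(IHg j _ _ gj mk1 Sy)/H.
- case: j => // j gj mk Sim.
  have jk : j <= k by lia.
  have mk' : m < k by lia.
  have mk1 : m.+1 + j <= k by rewrite addSnnS.
  split=> -[x Tx H].
    have [y Ty Sy] :=
        similar_move core mk' (game_radius_le jk) (game_depth_le jk) Sim Tx.
    by exists y => //; apply/(IHg j _ _ gj mk1 Sy).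
  have [y Ty Sy] :=
        similar_move (core_sym core) mk' (game_radius_le jk) (game_depth_le jk)
          (similar_sym Sim) Tx.
  by exists y => //; apply/(IHg j _ _ gj mk1 (similar_sym Sy)).
Qed.

Lemma holds_core (f : formula n 0) : qdepth f <= k ->
  holds T S f (fun=> [::]) -> holds T' S' f (fun=> [::]).
Proof.
move=> fk; suff Sim : similar k G G' K (game_radius k) (game_depth k)
    (fun=> [::]) (fun _ : 'I_0 => [::]).
  by have [] := holds_similar fk (leqnn _) Sim.
split=> [[]//|[]//| |].
  by move=> x x' y y' [[_ <-]|[[]//]] [[_ <-]|[[]//]].
by move=> x x' [[Kx <-]|[[]//]]; exact: core_type core _ Kx.
Qed.

End FirstOrder.

(** * Truncating and grafting trees *)

Lemma tree_ext (T T' : tree) : nodes T = nodes T' -> T = T'.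
Proof.
case: T T' => [A r p c] [A' r' p' c'] /= E; subst A'.
by congr Tree; exact: Prop_irrelevance.
Qed.

Program Definition trunc h (T : tree) : tree :=
  @Tree [set v | nodes T v /\ size v <= h]%classic _ _ _.
Next Obligation. by move=> h T; split => //; exact: nodes_root. Qed.
Next Obligation. by move=> h T i v [/nodes_parent Tv /= /ltnW]. Qed.
Next Obligation.
move=> h T v [Tv vh]; exists (if size v < h then arity T v else 0) => i.
case: ifP => vh' /=; last by split=> // -[]; rewrite vh'.
by split=> [[/(arityP _ Tv)]|/(arityP _ Tv)].
Qed.

Program Definition graft N (F : nat -> tree) : tree :=
  @Tree [set v | v = [::] \/
    exists u j, [/\ v = rcons u j, j < N & nodes (F j) u]]%classic _ _ _.
Next Obligation. by move=> N F; left. Qed.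
Next Obligation.
move=> N F i v [//|[[|a u] [j [/= [_ ->] jN Fu]]]]; first by left.
by right; exists u, j; split=> //; exact: nodes_parent Fu.
Qed.
Next Obligation.
move=> N F v [->|[u [j [-> jN Fu]]]].
  exists N => i; split=> [[//|[u [j [/(@rcons_inj _ [::] u)[_ ->]]]]//]|iN].
  by right; exists [::], i; split=> //; exact: nodes_root.
exists (arity (F j) u) => i; rewrite -rcons_cons -(arityP i Fu); split=> [|Fi].
  by case=> [//|[w [l [/rcons_inj[<- <-]]]]].
by right; exists (i :: u), j.
Qed.

Lemma graft_rcons N F u j : nodes (graft N F) (rcons u j) <-> j < N /\ nodes (F j) u.
Proof.
split=> [[|[w [l [/rcons_inj[<- <-]]]]]//|[jN Fu]]; first by case: u.
by right; exists u, j.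
Qed.

Lemma level_list (T : tree) h :
  exists s : seq node, forall v, nodes T v -> size v <= h -> v \in s.
Proof.
elim: h => [|h [s Hs]].
  by exists [:: [::]] => v _; rewrite leqn0 => /nilP ->; rewrite inE.
exists ([::] :: flatten [seq [seq i :: v | i <- iota 0 (arity T v)] | v <- s]).
case=> [|i v] Tv /= vh; first by rewrite inE.
rewrite inE /=; apply/flatten_mapP; exists v.
  by apply: Hs => //; exact: nodes_parent Tv.
apply/mapP; exists i => //; rewrite mem_iota add0n; apply/arityP => //.
exact: nodes_parent Tv.
Qed.

Lemma trunc_list h (T : tree) :
  exists s : seq node, forall v, nodes (trunc h T) v <-> v \in s.
Proof.
have [s Hs] := level_list T h.
exists [seq v <- s | `[< nodes (trunc h T) v >]] => v; rewrite mem_filter.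
split=> [Tv|/andP[/asboolP]//]; apply/andP; split; first exact/asboolP.
by case: Tv => Tv /(Hs _ Tv).
Qed.

Lemma finite_graft N F :
  (forall j, j < N -> finite_tree (F j)) -> finite_tree (graft N F).
Proof.
move=> finF; rewrite /finite_tree.
have : finite_set ([set [::]] `|`
    \bigcup_(j in `I_N) ((fun u => rcons u j) @` nodes (F j)))%classic.
  rewrite finite_setU; split; first exact: finite_set1.
  apply: bigcup_finite; first exact: finite_II.
  by move=> j /= jN; apply: finite_image; exact: finF.
apply: sub_finite_set => v [->|[u [j [-> jN Fu]]]]; first by left.
by right; exists j => //; exists u.
Qed.

Lemma infinite_graft N F j : j < N -> ~ finite_tree (F j) -> ~ finite_tree (graft N F).
Proof.
move=> jN infF fin; apply: infF.
apply: sub_finite_set (finite_image (fun v : node => take (size v).-1 v) fin) => u Fu.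
exists (rcons u j); first exact/graft_rcons.
by rewrite size_rcons -cats1 take_size_cat.
Qed.

Section ColoredGraft.
Variables (C : finType) (q : nat).
Implicit Types (F : nat -> ctree C) (V : ctree C).

(** An address is listed from the node up to the root, so the last entry of a
nonempty address is the index of the branch, and the rest is the address inside
that branch. *)
Definition graft_color (c0 : C) F (v : node) : C :=
  if v is _ :: _ then color (F (last 0 v)) (take (size v).-1 v) else c0.

Lemma graft_color_rcons c0 F u j : graft_color c0 F (rcons u j) = color (F j) u.
Proof.
rewrite /graft_color; case E : (rcons u j) => [|i v]; first by case: (u) E.
by rewrite -E last_rcons size_rcons -cats1 take_size_cat.
Qed.

Definition cgraft N c0 F : ctree C := CTree (graft N F) (graft_color c0 F).

Lemma type_of_graft d N c0 F u j : j < N -> nodes (F j) u ->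
  type_of q d (cgraft N c0 F) (rcons u j) = type_of q d (F j) u.
Proof.
move=> jN Fu; apply: type_of_agree => //; first exact/graft_rcons.
  by move=> s _; rewrite -rcons_cat graft_rcons; tauto.
by move=> s _ _; rewrite -rcons_cat /= graft_color_rcons.
Qed.

Lemma type_of_graft_root d N c0 F F' :
  (forall j, j < N -> type_of q d (F j) [::] = type_of q d (F' j) [::]) ->
  type_of q d (cgraft N c0 F) [::] = type_of q d (cgraft N c0 F') [::].
Proof.
elim: d => // d IHd Hj.
have Hd j : j < N -> type_of q d (F j) [::] = type_of q d (F' j) [::].
  by move/Hj; exact: type_of_le (leqnSn d).
rewrite /= IHd //; congr pair; apply/ffunP => t; rewrite !ffunE.
have arN H : arity (graft N H) [::] = N.
  apply: arity_unique; first by left.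
  move=> i; rewrite (graft_rcons N H [::] i); split=> [[]//|iN].
  by split=> //; exact: nodes_root.
rewrite !arN; congr (inord (minn _ _)).
apply: eq_in_count => j; rewrite mem_iota add0n => /andP[_ jN].
by rewrite -[[:: j]]/(rcons [::] j) !type_of_graft ?Hd //; exact: nodes_root.
Qed.

(** The word of a node [u] lists the local types of [u] and of its ancestors up
to distance [r], and where on this way the root is reached. *)
Definition words_in r d (G V : ctree C) : Prop := forall u, nodes G u ->
  exists u', [/\ nodes V u', forall a, a <= r -> (a < size u) = (a < size u') &
    forall a, a <= r -> type_of q d G (drop a u) = type_of q d V (drop a u')].

(** The root, its children, and the branches outside [J]. *)
Definition graft_core N F (J : seq nat) : set node :=
  [set v | v = [::] \/ exists u j,
    [/\ v = rcons u j, j < N, nodes (F j) u & u = [::] \/ j \notin J]]%classic.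

Section GraftCore.
Variables (N i0 r d : nat) (c0 : C) (V : ctree C) (J : seq nat).
Hypotheses (uJ : uniq J) (JN : forall j, j \in J -> j < N) (qJ : q < size J).

Lemma last_drop c (v : node) : drop c v <> [::] -> last 0 (drop c v) = last 0 v.
Proof.
move=> H; rewrite -[in RHS](cat_take_drop c v) last_cat.
by case: (drop c v) H.
Qed.

(** A node more than [r] levels down a branch of index in [J] has its word in
[V]. As [J] has more than [q] elements and fewer than [q] nodes have been
played, some copy of [V] has not been touched, even if the branch [i0] is left
out; the word is found again there. *)
Lemma graft_far F F' (K := graft_core N F J) :
  (forall j, j \notin J -> F j = F' j) ->
  (forall j, j \in J -> j != i0 -> F' j = V) ->
  (forall j, j \in J -> words_in r d (F j) V) ->
  far_extends q (cgraft N c0 F) (cgraft N c0 F') K r d.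
Proof.
move=> FF' F'V FV r' m e' b rr' mq Gb nKb.
case: Gb nKb => [->|[u [j [-> jN Fu]]]] nKb; first by case: (nKb 0 isT); left.
have jJ : j \in J.
  apply: contrapT => /negP jJ; apply: (nKb 0 isT); right.
  by exists u, j; rewrite drop0; split=> //; right.
have ru : r' < size u.
  rewrite ltnNge; apply/negP => ur; apply: (nKb (size u) ur); right.
  exists [::], j; rewrite -cats1 drop_size_cat //; split=> //; last by left.
  exact: nodes_root.
have [u' [Vu' su' tu']] := FV j jJ u Fu.
have [j' [j'J j'i j'e]] : exists j',
    [/\ j' \in J, j' != i0 & forall k, j' <> last 0 (e' k)].
  apply: contrapT => Hno.
  have : size J <= size (i0 :: [seq last 0 (e' k) | k : 'I_m]).
    apply: uniq_leq_size => // j' j'J; rewrite inE; case: eqP => //= /eqP j'i.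
    apply: contrapT => Hn; apply: Hno; exists j'; split=> // k Ek.
    by apply: Hn; apply/mapP; exists k => //; rewrite mem_enum.
  rewrite /= size_map -cardE card_ord; lia.
have ru' a : a <= r' -> a < size u /\ a < size u'.
  move=> ar; have au : a < size u by exact: leq_ltn_trans ru.
  by rewrite -su' ?au //; exact: leq_trans rr'.
have dr a (w : node) l : a < size w -> drop a (rcons w l) = rcons (drop a w) l.
  by move=> aw; rewrite -!cats1 drop_cat aw.
have F'u : nodes (F' j') u' by rewrite F'V.
exists (rcons u' j'); split.
- by apply/graft_rcons; split=> //; exact: JN.
- move=> a ar [|[w [l [+ lN _]]]]; have [_ au'] := ru' a ar.
    by rewrite dr // => /(congr1 size); rewrite size_rcons.
  rewrite dr // => /rcons_inj[<- <-] [|]; last by rewrite j'J.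
  by move=> /(congr1 size); rewrite size_drop /=; lia.
- move=> a ar; have [au au'] := ru' a ar.
  rewrite !dr // !type_of_graft //; first by rewrite tu' ?F'V //; exact: leq_trans rr'.
  + exact: JN.
  + exact: nodes_drop.
  + exact: nodes_drop.
- move=> a k c ar cr; have [_ au'] := ru' a ar; rewrite dr // => E.
  apply: (j'e k); rewrite -(@last_drop c) -?E ?last_rcons //.
  by case: (drop a u').
Qed.

(** Two grafts that differ only in the branch [i0], all other branches indexed by
[J] being equal to [V] in both, are related by the game whenever corresponding
branches have roots of the same type and the words of the branches in [J] occur
in [V]. *)
Lemma graft_core_of F F' :
  (forall j, j \notin J -> F j = F' j) ->
  (forall j, j \in J -> j != i0 -> F j = V /\ F' j = V) ->
  (forall j, j < N -> type_of q d (F j) [::] = type_of q d (F' j) [::]) ->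
  (forall j, j \in J -> words_in r d (F j) V /\ words_in r d (F' j) V) ->
  core_of q (cgraft N c0 F) (cgraft N c0 F') (graft_core N F J) r d.
Proof.
move=> FF' FV tF wF.
have EK : graft_core N F J = graft_core N F' J.
  apply/seteqP; split=> v [->|[u [j [-> jN Fu uj]]]]; [by left| |by left|];
  right; exists u, j; split=> //; case: uj => [->|jJ]; try exact: nodes_root.
    by rewrite -FF'.
  by rewrite FF'.
have sib H i j v : graft_core N H J (i :: v) -> nodes (graft N H) (j :: v) ->
    graft_core N H J (j :: v).
  case=> [//|[[|i' u] [l [/= [_ Ev] lN Hu ul]]]].
    rewrite Ev => /(graft_rcons N H [::] j)[jN _]; right.
    by exists [::], j; split=> //; [exact: nodes_root|left].
  case: ul => // lJ; rewrite Ev => /(graft_rcons N H (j :: u) l)[_ Hju]; right.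
  by exists (j :: u), l; split=> //; right.
have nod H v : graft_core N H J v -> nodes (graft N H) v.
  by case=> [->|[u [j [-> jN Hu _]]]]; [left|right; exists u, j].
split.
- by left.
- move=> i v [//|[[|i' u] [l [/= [_ ->] lN Hu ul]]]]; first by left.
  case: ul => // lJ; right; exists u, l; split=> //; last by right.
  exact: nodes_parent Hu.
- exact: sib.
- rewrite EK; exact: sib.
- exact: nod.
- rewrite EK; exact: nod.
- move=> v [->|[u [j [-> jN Fu uj]]]]; first exact: type_of_graft_root.
  case: uj => [E|jJ]; last by rewrite !type_of_graft // -?FF'.
  by rewrite E !type_of_graft ?tF //; exact: nodes_root.
- apply: graft_far => // j jJ; first by move=> /(FV j jJ)[].
  by have [] := wF j jJ.
- rewrite EK; apply: graft_far => [j jJ|j jJ|j jJ]; first by rewrite FF'.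
    by move=> /(FV j jJ)[].
  by have [] := wF j jJ.
Qed.

End GraftCore.
End ColoredGraft.

(** * Replacing one of many equal branches by an infinite tree *)

Lemma large_fiber (X : finType) q N (f : nat -> X) : q * #|X| < N ->
  exists x (J : seq nat), [/\ uniq J, q < size J &
    forall j, j \in J -> j < N /\ f j = x].
Proof.
move=> XN; apply: contrapT => Hno.
have Hx x : count (fun j => f j == x) (iota 0 N) <= q.
  rewrite leqNgt -size_filter; apply/negP => Hq; apply: Hno.
  exists x, [seq j <- iota 0 N | f j == x]; split=> //.
    exact/filter_uniq/iota_uniq.
  by move=> j; rewrite mem_filter mem_iota add0n => /andP[/eqP ? /andP[]].
have : N <= \sum_(x : X) q.
  rewrite -[leqLHS](size_iota 0).
  apply: (@leq_trans (\sum_x count (fun j => f j == x) (iota 0 N)));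
    last exact: leq_sum.
  rewrite -sum1_size; have -> : \sum_x count (fun j => f j == x) (iota 0 N) =
      \sum_x \sum_(j <- iota 0 N | f j == x) 1.
    by apply: eq_bigr => x _; rewrite sum1_count.
  rewrite (exchange_big_dep xpredT) //= leq_sum // => j _.
  rewrite sum1dep_card (eq_card (B := pred1 (f j))) ?card1 // => x.
  by rewrite !inE eq_sym.
by rewrite sum_nat_const mulnC leqNgt XN.
Qed.

(** There are finitely many colorings of the finite tree [V], so the pigeonhole
principle gives many identically colored branches. *)
Lemma equal_copies (A : emso) (V : tree) q :
  (forall T, finite_tree T -> satisfies T A) -> finite_tree V ->
  exists N S (kappa : node -> {set 'I_(emso_sets A)}) (J : seq nat), [/\
    forall i, (S i `<=` nodes (graft N (fun=> V)))%classic,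
    holds (graft N (fun=> V)) S (emso_matrix A) (fun=> [::]),
    uniq J, q < size J &
    forall j, j \in J -> j < N /\ forall u, colors_of S (rcons u j) = kappa u].
Proof.
move=> finA finV; have [s Es] := (finite_seqP _).1 finV.
pose X := {ffun 'I_(size s) -> {set 'I_(emso_sets A)}}.
pose N := (q * #|X|).+1.
have [|S [sS hS]] := finA (graft N (fun=> V)); first by apply: finite_graft.
pose f j : X := [ffun a => colors_of S (rcons (nth [::] s (a : 'I_(size s))) j)].
have [x [J [uJ qJ HJ]]] := @large_fiber X q N f (ltnSn _).
exists N, S, (fun u => colors_of S (rcons u (head 0 J))), J; split=> // j jJ.
have [jN fj] := HJ j jJ; split=> // u.
have hJ : head 0 J \in J by case: (J) jJ => //= a l _; rewrite inE eqxx.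
have [_ fh] := HJ _ hJ.
have [us|us] := boolP (u \in s).
  have lus : index u s < size s by rewrite index_mem.
  have := congr1 (fun g : X => g (Ordinal lus)) (etrans fj (esym fh)).
  by rewrite !ffunE /= nth_index.
(* Both colors are empty off the nodes of [V], because the sets consist of nodes
   of the tree. *)
have out l i : (i \in colors_of S (rcons u l)) = false.
  rewrite inE; apply/asboolP => /sS /graft_rcons[_].
  by rewrite Es => /= us'; rewrite us' in us.
by apply/setP => i; rewrite !out.
Qed.

(** The limit color of a node contains an index if its colors do so for almost all
[h], in the sense of an ultrafilter refining [eventually]. *)
Lemma limit_coloring n (kappa : nat -> node -> {set 'I_n}) :
  exists c : node -> {set 'I_n}, forall (s : seq node) m,
    exists2 h, m <= h & forall v, v \in s -> kappa h v = c v.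
Proof.
have [F [FU FF]] := ultraFilterLemma (eventually_filter : ProperFilter eventually).
have FP : ProperFilter F := @ultra_proper _ _ FU.
pose c v : {set 'I_n} := [set i | `[< F [set h | i \in kappa h v]%classic >]].
exists c => s m.
have H1 v : F [set h | kappa h v = c v]%classic.
  have : F [set h | forall i : 'I_n, (i \in kappa h v) = (i \in c v)]%classic.
    apply: filter_forall => i; rewrite inE; case: asboolP => Fi.
      by apply: filterS Fi => h /= ->.
    have [//|] := @in_ultra_setVsetC _ F [set h | i \in kappa h v]%classic FU.
    by apply: filterS => h /= /negP/negbTE.
  by apply: filterS => h /= H; apply/setP.
have : F [set h | m <= h /\ forall v, v \in s -> kappa h v = c v]%classic.
  elim: s => [|v s IHs].
    by apply: FF; exists m => // h /= mh; split.
  apply: filterS (filterI IHs (H1 v)) => h /= [[mh Hs] Hv]; split=> // w.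
  by rewrite inE => /orP[/eqP->|/Hs].
by case/filter_ex => h [mh Hs]; exists h.
Qed.

(** The words lie in a finite type, so finitely many nodes realize all the words
that occur in [G]. *)
Lemma words_finite (C : finType) q r d (G : ctree C) :
  exists m, forall u, nodes G u -> exists u', [/\ nodes G u', size u' <= m,
    forall a, a <= r -> (a < size u) = (a < size u') &
    forall a, a <= r -> type_of q d G (drop a u) = type_of q d G (drop a u')].
Proof.
pose W : finType := ('I_r.+2 * {ffun 'I_r.+1 -> ltype C q d})%type.
pose word u : W := (inord (minn (size u) r.+1),
   [ffun a => type_of q d G (drop (a : 'I_r.+1) u)]).
have /choice[g Hg] : forall w : W, exists u', (exists2 u, nodes G u & word u = w) ->
    nodes G u' /\ word u' = w.
  move=> w; have [[u Gu uw]|no] := EM (exists2 u, nodes G u & word u = w).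
    by exists u.
  by exists [::] => H; case: no.
(* [g w] is a node with word [w], if there is one. *)
exists (\max_(w : W) size (g w)) => u Gu.
have [|Ggu [Es /ffunP Et]] := Hg (word u); first by exists u.
exists (g (word u)); split=> //; first exact: (leq_bigmax (word u)).
  move=> a ar; have /(congr1 val) := Es; rewrite /= !inordK ?ltnS ?geq_minr //; lia.
by move=> a ar; have := Et (Ordinal (ar : a < r.+1)); rewrite !ffunE.
Qed.

Lemma replace_copy (A : emso) (U : tree) :
  (forall T, finite_tree T -> satisfies T A) ->
  exists h N i, i < N /\
    satisfies (graft N (fun j => if j == i then U else trunc h U)) A.
Proof.
move=> finA; pose n := emso_sets A; pose k := qdepth (emso_matrix A).
pose r := game_radius k; pose d := game_depth k.
have fin h : finite_tree (trunc h U).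
  have [s Hs] := trunc_list h U; apply/finite_seqP; exists s.
  by apply/seteqP; split=> v /Hs.
pose stage h N S (kappa : node -> {set 'I_n}) (J : seq nat) := [/\
    forall i, (S i `<=` nodes (graft N (fun=> trunc h U)))%classic,
    holds (graft N (fun=> trunc h U)) S (emso_matrix A) (fun=> [::]),
    uniq J, k < size J &
    forall j, j \in J -> j < N /\ forall u, colors_of S (rcons u j) = kappa u].
have /choice[kappa Hkappa] h : exists kappa, exists N S J, stage h N S kappa J.
  by have [N [S [ka [J HJ]]]] := equal_copies k finA (fin h); exists ka, N, S, J.
have [c Hc] := limit_coloring kappa.
pose Uc := CTree U c.
have cU u i : i \in c u -> nodes U u.
  have [h _ Eh] := Hc [:: u] 0; rewrite -Eh ?inE //.
  have [N [S [J [sS _ _ kJ HJ]]]] := Hkappa h.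
  have hJ : head 0 J \in J by case: (J) kJ => //= a l _; rewrite inE eqxx.
  have [_ <-] := HJ _ hJ; rewrite inE => /asboolP/sS/graft_rcons[_].
  by case.
have [m Hm] := words_finite k r d Uc.
have [s Hs] := level_list U (m + d).
have [h mh Eh] := Hc s (m + d).
have [N [S [J [sS hS uJ kJ HJ]]]] := Hkappa h.
pose V := CTree (trunc h U) (kappa h).
(* The truncation and its coloring agree with the colored tree [U] down to level
   [m + d], so the local types agree down to level [m]. *)
have tyV u : nodes U u -> size u <= m -> type_of k d Uc u = type_of k d V u.
  move=> Uu um; have sz t : size t <= d -> size (t ++ u) <= m + d.
    by rewrite size_cat addnC => td; exact: leq_add.
  apply: type_of_agree => // [|t td|t td Ut].
  - by split=> //; exact: leq_trans um (leq_trans (leq_addr _ _) mh).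
  - by split=> [Ut|[]//]; split=> //; exact: leq_trans (sz t td) mh.
  - by rewrite /= Eh //; exact: Hs Ut (sz t td).
have wUV : words_in k r d Uc V.
  move=> u Uu; have [u' [Uu' u'm Es Et]] := Hm u Uu.
  exists u'; split=> // [|a ar].
    by split=> //; exact: leq_trans u'm (leq_trans (leq_addr _ _) mh).
  rewrite Et // tyV //; first exact: nodes_drop.
  by rewrite size_drop; lia.
have wVV : words_in k r d V V by move=> u Vu; exists u.
pose i := head 0 J.
have iJ : i \in J by rewrite /i; case: (J) kJ => //= a l _; rewrite inE eqxx.
pose F j := CTree (trunc h U) (fun u => colors_of S (rcons u j)).
pose F' j := if j == i then Uc else F j.
have FJ j : j \in J -> F j = V.
  by move=> jJ; congr CTree; apply/funext => u; have [_ ->] := HJ j jJ.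
pose c0 := colors_of S [::].
pose S' l := [set v | l \in graft_color c0 F' v]%classic.
pose T' := graft N F'.
have ES : colors_of S = graft_color c0 F.
  by apply/funext => v; case/lastP: v => // u j; rewrite graft_color_rcons.
have ES' : colors_of S' = graft_color c0 F'.
  by apply/funext => v; apply/setP => l; rewrite inE /S' /= asboolb.
have core : core_of k (CTree (graft N (fun=> trunc h U)) (colors_of S))
    (CTree T' (colors_of S')) (graft_core N F J) r d.
  rewrite ES ES'; apply: (@graft_core_of _ k N i r d c0 V J uJ _ kJ F F') => //.
  - by move=> j /HJ[].
  - by move=> j jJ; rewrite /F' ifN //; apply: contraNneq jJ => ->.
  - by move=> j jJ ji; rewrite /F' ifN // FJ.
  - move=> j jN; rewrite /F'; case: eqP => // ->.
    by rewrite FJ // tyV //; exact: nodes_root.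
  - move=> j jJ; rewrite /F' FJ //; split=> //.
    by case: eqP.
exists h, N, i; split; first by have [] := HJ i iJ.
have -> : graft N (fun j => if j == i then U else trunc h U) = T'.
  by congr graft; apply/funext => j; rewrite /F'; case: eqP.
exists S'; split; last exact: (holds_core core (leqnn _)) hS.
move=> l v; rewrite /S' /=; case/lastP: v => [_|u j]; first by left.
rewrite graft_color_rcons /T' /F' => Hl; apply/graft_rcons.
have [iN _] := HJ i iJ; move: Hl; case: eqP => [-> /cU //|_].
by rewrite inE => /asboolP/sS/graft_rcons.
Qed.

(** * Measurability in the space of trees *)

(** Whether finitely many nodes belong to a random tree depends on finitely many
offspring numbers, each subject to a condition of its own. This turns events on
finitely many nodes into cylinders, to which the product rule applies. *)
Lemma finite_conditions (t : seq node) :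
  exists (s : seq node) (B : node -> set nat), uniq s /\
    forall c, (forall v, v \in t -> offspring_nodes c v) <->
              (forall u, u \in s -> B u (c u)).
Proof.
have onP c v : offspring_nodes c v <->
    forall a, a < size v -> nth 0 v a < c (drop a.+1 v).
  elim: v => [|i v IHv] /=; first by split.
  split=> [[/IHv Hv iv] [|a] /= av|H].
  - by rewrite drop0.
  - exact: Hv.
  - split; first by apply/IHv => a av; exact: (H a.+1).
    by have := H 0 isT; rewrite /= drop0.
pose s := undup (flatten [seq [seq drop a.+1 v | a <- iota 0 (size v)] | v <- t]).
exists s, (fun u => [set k | forall v a, v \in t -> a < size v ->
   drop a.+1 v = u -> nth 0 v a < k])%classic.
split=> [|c]; first exact: undup_uniq.
split=> [H u us v a vt av <-|H v vt]; first by have /onP/(_ a av) := H v vt.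
apply/onP => a av; apply: (H _ _ v a) => //.
rewrite mem_undup; apply/flatten_mapP; exists v => //.
by apply/mapP; exists a => //; rewrite mem_iota.
Qed.

Lemma offspring_tree_graft (c : node -> nat) :
  offspring_tree c = graft (c [::]) (fun j => offspring_tree (fun u => c (rcons u j))).
Proof.
apply: tree_ext; apply/seteqP; split=> v /=.
  elim: v => [|i v IHv] /=; first by left.
  case=> /IHv[->|[u [j [-> jN Fu]]]] iv.
    by right; exists [::], i.
  by right; exists (i :: u), j.
case=> [->//|[u [j [-> jN Fu]]]].
by elim: u Fu => [//|i u IHu] /= [/IHu Fu iu].
Qed.

Lemma eq_graft N (F F' : nat -> tree) : (forall j, j < N -> F j = F' j) ->
  graft N F = graft N F'.
Proof.
move=> FF'; apply: tree_ext; apply/seteqP; split=> v [->|[u [j [-> jN Fu]]]];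
  [by left| |by left|]; right; exists u, j; split=> //.
  by rewrite -FF'.
by rewrite FF'.
Qed.

Lemma measurable_node v : measurable ([set T | nodes T v]%classic : set tree_space).
Proof. by apply: sub_sigma_algebra; exists v. Qed.

Lemma measurable_node_iff v (Q : Prop) :
  measurable ([set T | nodes T v <-> Q]%classic : set tree_space).
Proof.
have [HQ|HQ] := EM Q.
  have -> : [set T | nodes T v <-> Q]%classic = [set T | nodes T v]%classic.
    by apply/seteqP; split=> T /=; tauto.
  exact: measurable_node.
have -> : [set T | nodes T v <-> Q]%classic = (~` [set T | nodes T v])%classic.
  by apply/seteqP; split=> T /=; tauto.
exact: measurableC (measurable_node v).
Qed.

Lemma measurable_forall_node (B : node -> set tree_space) :
  (forall v, measurable (B v)) -> measurable (\bigcap_v B v)%classic.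
Proof.
move=> mB; have -> : (\bigcap_v B v =
    \bigcap_n (if unpickle n is Some v then B v else setT))%classic.
  apply/seteqP; split=> T BT => [n _|v _]; first by case: unpickle => // v; exact: BT.
  by have := BT (pickle v) I; rewrite pickleK.
by apply: bigcapT_measurable => n; case: unpickle.
Qed.

Lemma measurable_tree d (Omega : measurableType d) (f : Omega -> tree_space) :
  (forall v, measurable [set w | nodes (f w) v]%classic) -> measurable_fun setT f.
Proof.
move=> mf; apply: (@measurability _ _ Omega tree_space setT f node_events erefl).
by move=> _ [_ [v _ <-] <-]; rewrite setTI; exact: mf.
Qed.

(** * The branching property *)

Section MeasureUnique.
Local Open Scope ring_scope.
Local Open Scope classical_set_scope.
Local Open Scope ereal_scope.

(** The events that finitely many given nodes belong to the tree form a
generating family that is closed under intersections. *)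
Lemma tree_measure_unique (R : realType) (m1 m2 : {measure set tree_space -> \bar R}) :
  m1 setT < +oo ->
  (forall t : seq node, m1 [set T | forall v, v \in t -> nodes T v] =
                        m2 [set T | forall v, v \in t -> nodes T v]) ->
  forall A, measurable A -> m1 A = m2 A.
Proof.
move=> m1oo m12; pose G : set (set tree_space) :=
  [set A | exists t : seq node, A = [set T | forall v, v \in t -> nodes T v]].
have GT : G setT by exists [::]; apply/seteqP; split.
apply: (measure_unique G (fun=> setT)) => //.
- apply/seteqP; split.
    apply: smallest_sub; first exact: smallest_sigma_algebra.
    move=> _ [v _ <-]; apply: sub_sigma_algebra; exists [:: v].
    apply/seteqP; split=> T /=; first by move=> Tv w; rewrite inE => /eqP ->.
    by apply; rewrite inE.
  apply: smallest_sub; first exact: smallest_sigma_algebra.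
  move=> _ [t ->].
  rewrite (_ : mkset _ = \bigcap_(v in [set` t]) [set T | nodes T v]) //.
  apply: (@fin_bigcap_measurable _ tree_space); first exact: finite_seq.
  by move=> v _; exact: measurable_node.
- move=> _ _ [t ->] [t' ->]; exists (t ++ t'); apply/seteqP; split=> T /=.
    by case=> Tt Tt' v; rewrite mem_cat => /orP[/Tt|/Tt'].
  by move=> H; split=> v vt; apply: H; rewrite mem_cat vt ?orbT.
- by apply: bigcup_const; exists 0%N.
- by move=> _ [t ->]; exact: m12.
Qed.

(** Both sides are finite measures in [A]; they agree on a generating family, so
they agree everywhere. *)
Lemma independent_of_tree d (Omega : measurableType d) (R : realType)
    (P : probability Omega R) (mu : probability tree_space R)
    (f : Omega -> tree_space) (D : set Omega) :
  measurable D -> measurable_fun setT f ->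
  (forall t : seq node, P (f @^-1` [set T | forall v, v \in t -> nodes T v] `&` D) =
     P D * mu [set T | forall v, v \in t -> nodes T v]) ->
  forall A, measurable A -> P (f @^-1` A `&` D) = P D * mu A.
Proof.
move=> mD mf H A mA.
have finPD : P D \is a fin_num by exact: fin_num_measure.
have PD0 := fine_ge0 (measure_ge0 P D).
pose m0 : {measure set Omega -> \bar R} := mrestr P mD.
pose m1 : {measure set tree_space -> \bar R} := pushforward m0 f.
pose m2 : {measure set tree_space -> \bar R} := mscale (NngNum PD0) mu.
have m2E B : m2 B = P D * mu B by rewrite /m2 /= /mscale /= fineK.
rewrite -m2E -[LHS]/(m1 mf A); apply: tree_measure_unique => //.
  rewrite /m1 /m0 /= /pushforward /mrestr /= preimage_setT setTI.
  by rewrite ltey_eq finPD.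
by move=> t; rewrite m2E; exact: H.
Qed.

End MeasureUnique.

Section GaltonWatson.
Variables (R : realType) (chi : probability nat R) (mu : probability tree_space R).
Variables (d : measure_display) (Omega : measurableType d).
Variables (P : probability Omega R) (X : node -> {RV P >-> nat}).
Hypothesis iid : iid_family chi X.

Definition gw_tree (w : Omega) : tree_space := offspring_tree (fun v => X v w).
Definition gw_subtree j (w : Omega) : tree_space :=
  offspring_tree (fun v => X (rcons v j) w).

Hypothesis law : forall A : set tree_space, measurable A ->
  mu A = P [set w | A (gw_tree w)]%classic.

Definition cylinder (s : seq node) (B : node -> set nat) : set Omega :=
  (\bigcap_(v in [set` s]) (X v @^-1` B v))%classic.

Lemma measurable_cylinder s B : measurable (cylinder s B).
Proof.
apply: fin_bigcap_measurable => [|v _]; first exact: finite_seq.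
exact: measurable_funPTI.
Qed.

Lemma cylinder_prob s B : uniq s -> P (cylinder s B) = (\prod_(v <- s) chi (B v))%E.
Proof. by move=> us; rewrite iid.2 //; apply: eq_bigr => v _; rewrite iid.1. Qed.

Lemma measurable_gw (sigma : node -> node) :
  measurable_fun setT (fun w => offspring_tree (fun v => X (sigma v) w) : tree_space).
Proof.
apply: measurable_tree => v /=; elim: v => [|i v IHv] /=; first exact: measurableT.
apply: measurableI => //.
by have := measurable_funPTI (X (sigma v)) (I : measurable [set k | i < k]%classic).
Qed.

Lemma measurable_gw_tree : measurable_fun setT gw_tree.
Proof. exact: (measurable_gw id). Qed.

Lemma measurable_gw_subtree j : measurable_fun setT (gw_subtree j).
Proof. exact: (measurable_gw (rcons^~ j)). Qed.

Definition subtree_event m (E : nat -> set tree_space) : set Omega :=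
  [set w | forall j, j < m -> E j (gw_subtree j w)]%classic.

Lemma measurable_subtree_event m E : (forall j, measurable (E j)) ->
  measurable (subtree_event m E).
Proof.
move=> mE; rewrite (_ : subtree_event m E =
    (\bigcap_(j in `I_m) (gw_subtree j @^-1` E j))%classic) //.
apply: fin_bigcap_measurable => [|j _]; first exact: finite_II.
by rewrite -[X in measurable X]setTI; exact: measurable_gw_subtree.
Qed.

(** Induction on [m]. To add the branch [m], [independent_of_tree] reduces its
event to one about finitely many nodes, which is a cylinder; this cylinder joins
[cylinder s B], and the induction hypothesis applies to the longer cylinder. *)
Lemma subtree_independence m s B E : uniq s ->
  (forall v, v \in s -> v = [::] \/ m <= last 0 v) ->
  (forall j, measurable (E j)) ->
  (P (cylinder s B `&` subtree_event m E)%classic =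
   P (cylinder s B) * \prod_(j < m) mu (E j))%E.
Proof.
elim: m s B E => [|m IHm] s B E us sm mE.
  rewrite big_ord0 mule1; congr (P _); apply/seteqP; split=> w; first by case.
  by move=> ?; split.
pose D := (cylinder s B `&` subtree_event m E)%classic.
have mD : measurable D.
  by apply: measurableI; [exact: measurable_cylinder|exact: measurable_subtree_event].
have PD : P D = (P (cylinder s B) * \prod_(j < m) mu (E j))%E.
  by apply: IHm => // v /sm[->|]; [left|right; exact: ltnW].
have -> : (cylinder s B `&` subtree_event m.+1 E =
    gw_subtree m @^-1` E m `&` D)%classic.
  apply/seteqP; split=> w.
    move=> [sw Ew]; split; first exact: Ew.
    by split=> // j jm; apply: Ew; exact: ltnW.
  move=> [Em [sw Ew]]; split=> // j; rewrite ltnS leq_eqVlt => /orP[/eqP->//|].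
  exact: Ew.
rewrite big_ord_recr /= muleA -PD.
apply: independent_of_tree => //; first exact: measurable_gw_subtree.
move=> t; have [s0 [B0 [us0 H0]]] := finite_conditions t.
pose s' := s ++ [seq rcons v m | v <- s0].
(* The conditions on the branch [m] are those of [s0], moved to addresses ending
   in [m]; by [disj] they concern nodes outside [s]. *)
pose B' v := if v \in s then B v else B0 (take (size v).-1 v).
have disj v : rcons v m \notin s.
  by apply/negP => /sm[|]; [case: v|rewrite last_rcons ltnn].
have us' : uniq s'.
  rewrite cat_uniq us (map_inj_uniq (@rcons_injl _ m)) us0 andbT /=.
  by apply/hasPn => _ /mapP[v _ ->]; exact: disj.
have B'r v : B' (rcons v m) = B0 v.
  by rewrite /B' (negbTE (disj v)) size_rcons -cats1 take_size_cat.
have -> : (gw_subtree m @^-1` [set T | forall v, v \in t -> nodes T v] `&` D =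
    cylinder s' B' `&` subtree_event m E)%classic.
  apply/seteqP; split=> w.
    move=> [tw [sw Ew]]; split=> // v /=; rewrite mem_cat => /orP[vs|].
      by rewrite /B' vs; exact: sw.
    by case/mapP => u us0' ->; rewrite B'r; exact: ((H0 _).1 tw u us0').
  move=> [sw Ew]; split; last split=> //.
    apply/H0 => u us0'; rewrite -B'r; apply: sw => /=.
    by rewrite mem_cat (map_f (rcons^~ m) us0') orbT.
  move=> v vs; have := sw v; rewrite /= /B' mem_cat vs; exact.
rewrite IHm //; last first.
  move=> v; rewrite mem_cat => /orP[/sm[->|]|/mapP[u _ ->]]; first by left.
    by right; exact: ltnW.
  by right; rewrite last_rcons.
rewrite PD [RHS]muleAC; congr (_ * _)%E.
rewrite law; last first.
  rewrite (_ : mkset _ = \bigcap_(v in [set` t]) [set T | nodes T v])%classic //.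
  apply: (@fin_bigcap_measurable _ tree_space); first exact: finite_seq.
  by move=> v _; exact: measurable_node.
have -> : [set w | [set T | forall v, v \in t -> nodes T v] (gw_tree w)]%classic =
    cylinder s0 B0.
  by apply/seteqP; split=> w; move/(H0 (fun v => X v w)).
rewrite !cylinder_prob // big_cat big_map /=; congr (_ * _)%E.
  by apply: eq_big_seq => v vs; rewrite /B' vs.
by apply: eq_bigr => v _; rewrite B'r.
Qed.

Lemma branching N E : (forall j, measurable (E j)) ->
  P [set w | X [::] w = N /\ forall j, j < N -> E j (gw_subtree j w)]%classic =
  (chi [set N]%classic * \prod_(j < N) mu (E j))%E.
Proof.
move=> mE; have := @subtree_independence N [:: [::]] (fun=> [set N]%classic) E isT.
rewrite cylinder_prob // big_seq1 => <- //; last first.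
  by move=> v; rewrite inE => /eqP->; left.
congr (P _); apply/seteqP; split=> w [Xw Ew]; split=> //.
  by move=> v /=; rewrite inE => /eqP ->.
by apply: (Xw [::]) => /=; rewrite inE.
Qed.

End GaltonWatson.

(** * Null sets of infinite trees *)

Section NullSets.
Variables (R : realType) (chi : probability nat R) (mu : probability tree_space R).
Variables (d : measure_display) (Omega : measurableType d).
Variables (P : probability Omega R) (X : node -> {RV P >-> nat}).
Hypothesis iid : iid_family chi X.
Hypothesis law : forall A : set tree_space, measurable A ->
  mu A = P [set w | A (gw_tree X w)]%classic.
Hypothesis chi_gt0 : forall i, (0 < chi [set i]%classic)%E.

Lemma measurable_tree1 (Z : tree) : measurable ([set Z]%classic : set tree_space).
Proof.
have -> : [set Z]%classic = (\bigcap_v [set T | nodes T v <-> nodes Z v])%classic.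
  apply/seteqP; split=> T; first by move=> -> v _.
  by move=> H; apply: tree_ext; apply/seteqP; split=> v /(H v I).
by apply: measurable_forall_node => v; exact: measurable_node_iff.
Qed.

Lemma prode_neq0 (I : Type) (s : seq I) (Q : pred I) (f : I -> \bar R) :
  (forall i, Q i -> f i != 0%E) -> (\prod_(i <- s | Q i) f i != 0)%E.
Proof.
move=> Hf; apply: (big_ind (fun x : \bar R => x != 0%E)) => //.
by move=> x y x0 y0; exact: mule_neq0.
Qed.

(** A finite tree is prescribed by the offspring numbers of its nodes. *)
Lemma finite_tree_gt0 (Z : tree) : finite_tree Z -> mu [set Z]%classic != 0%E.
Proof.
move=> /finite_seqP[s Es]; rewrite (law (measurable_tree1 Z)).
pose B v := [set arity Z v]%classic.
have sub : (cylinder X (undup s) B `<=` [set w | gw_tree X w = Z])%classic.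
  move=> w Hw; apply: tree_ext.
  have Hc v : nodes Z v -> X v w = arity Z v.
    by rewrite Es => /= vs; apply: (Hw v) => /=; rewrite mem_undup.
  apply/seteqP; split=> v /=.
    elim: v => [|i v IHv] /=; first by move=> _; exact: nodes_root.
    by case=> /IHv Zv; rewrite Hc // => iv; exact/arityP.
  elim: v => [//|i v IHv] /= Ziv; have Zv := nodes_parent Ziv.
  by split; [exact: IHv|rewrite Hc //; exact/arityP].
have : (0 < P (cylinder X (undup s) B))%E.
  rewrite (cylinder_prob iid) ?undup_uniq // lt0e prode_ge0 ?andbT //.
  by apply: prode_neq0 => v _; rewrite gt_eqF ?chi_gt0.
move=> /lt_le_trans/(_ (le_measure P _ _ sub)) H; rewrite gt_eqF // H //.
  by rewrite inE; exact: measurable_cylinder.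
rewrite inE -[X in measurable X]setTI.
exact: (measurable_gw_tree X measurableT (measurable_tree1 Z)).
Qed.

Lemma measurable_graft N i Z : measurable_fun setT
  (fun U : tree_space => graft N (fun j => if j == i then U else Z) : tree_space).
Proof.
have mconst (Q : Prop) : measurable ([set _ | Q]%classic : set tree_space).
  have [q|q] := EM Q; [have -> : [set _ : tree_space | Q]%classic = setT|
    have -> : [set _ : tree_space | Q]%classic = set0] => //.
  - by apply/seteqP; split.
  - by apply/seteqP; split.
apply: measurable_tree => v; case/lastP: v => [|u j].
  rewrite (_ : mkset _ = setT) //.
  by apply/seteqP; split=> // U _ /=; left.
have -> : [set U : tree_space |
      nodes (graft N (fun l => if l == i then U else Z)) (rcons u j)]%classic =
    ([set _ | (j < N)%N] `&`
     (if j == i then [set U | nodes U u] else [set _ | nodes Z u]))%classic.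
  apply/seteqP; split=> U.
    by move=> /graft_rcons[jN]; case: eqP.
  by move=> [jN Uu]; apply/graft_rcons; split=> //; move: Uu; case: eqP.
apply: measurableI => //; case: eqP => _ //; exact: measurable_node.
Qed.

(** Conditionally on the root having [N] children and all branches but the [i]-th
being [Z], an event of positive probability, the [i]-th branch has law [mu] and
the tree lies in [Nul] whenever the branch lies in the set in question. *)
Lemma graft_null (Nul : set tree_space) N i Z :
  measurable Nul -> mu Nul = 0%E -> (i < N)%N -> finite_tree Z ->
  mu.-negligible [set U | Nul (graft N (fun j => if j == i then U else Z))]%classic.
Proof.
move=> mNul Nul0 iN finZ; set Q := mkset _.
have mQ : measurable (Q : set tree_space).
  rewrite -[X in measurable X]setTI; exact: (measurable_graft N i Z measurableT mNul).
apply/negligibleP => //.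
pose E j : set tree_space := if j == i then Q else [set Z]%classic.
have mE j : measurable (E j) by rewrite /E; case: eqP => _ //; exact: measurable_tree1.
have H0 : (chi [set N]%classic * \prod_(j < N) mu (E j))%E = 0%E.
  rewrite -(branching iid law N mE); apply/eqP.
  rewrite eq_le measure_ge0 andbT -Nul0 (law mNul); apply: le_measure.
  - rewrite inE.
    rewrite (_ : mkset _ = (X [::] @^-1` [set N] `&` subtree_event X N E)%classic) //.
    by apply: measurableI; [exact: measurable_funPTI|exact: measurable_subtree_event].
  - rewrite inE -[X in measurable X]setTI.
    exact: (measurable_gw_tree X measurableT mNul).
  move=> w /= [Xw Ew]; rewrite /gw_tree offspring_tree_graft Xw.
  have := Ew i iN; rewrite /E eqxx /Q /=; congr (Nul _).
  apply: eq_graft => j jN; have := Ew j jN; rewrite /E.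
  by case: eqP => [->|_ /= /esym].
move/eqP: H0; rewrite mule_eq0 gt_eqF ?chi_gt0 //= (bigD1 (Ordinal iN)) //= mule_eq0.
rewrite {1}/E eqxx => /orP[/eqP //|].
move=> /eqP Z0; exfalso; move: Z0; apply/eqP; apply: prode_neq0 => j.
by rewrite -val_eqE /E /= => /negbTE ->; exact: finite_tree_gt0.
Qed.

(** By [replace_copy], each infinite tree lies in one of the null sets of
[graft_null]. They are indexed by [N], [i] and a finite tree, and finite trees
are encoded by lists of their nodes to make the union countable. *)
Lemma infinite_negligible (T0 : set tree) (A : emso) :
  mu.-negligible T0 -> (forall T, finite_tree T -> satisfies T A) ->
  (forall T, ~ finite_tree T -> ~ T0 T -> ~ satisfies T A) ->
  mu.-negligible [set T | ~ finite_tree T]%classic.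
Proof.
move=> [Nul [mNul Nul0 T0Nul]] finA infA.
pose F n : set tree_space := [set U |
  if unpickle n is Some (N, i, s) then exists Z : tree,
    [/\ (i < N)%N, nodes Z = [set` (s : seq node)] &
        Nul (graft N (fun j => if j == i then U else Z))] else False]%classic.
apply: (@negligibleS _ _ _ _ (\bigcup_n F n)%classic).
  move=> U infU; have [h [N [i [iN sat]]]] := replace_copy U finA.
  have [s Hs] := trunc_list h U.
  exists (pickle (N, i, s)) => //; rewrite /F /= pickleK; exists (trunc h U).
  split=> //; first by apply/seteqP; split=> v /Hs.
  apply: T0Nul; apply: contrapT => nT0; apply: infA nT0 sat.
  by apply: (infinite_graft iN); rewrite eqxx.
apply: negligible_bigcup => n; rewrite /F.
case: unpickle => [[[N i] s]|]; last first.
  by rewrite (_ : mkset _ = set0) //; exact: negligible_set0.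
have [[Z [iN EZ]]|no] := EM (exists Z : tree, (i < N)%N /\ nodes Z = [set` s]%classic).
  have finZ : finite_tree Z by apply/finite_seqP; exists s.
  apply: negligibleS (graft_null mNul Nul0 iN finZ) => U [Z' [_ EZ']].
  by have -> : Z' = Z by apply: tree_ext; rewrite EZ.
rewrite (_ : mkset _ = set0); first exact: negligible_set0.
by apply/seteqP; split=> U //= [Z [iN EZ _]]; apply: no; exists Z.
Qed.

End NullSets.

(** * Survival with positive probability *)

Section Survival.
Local Open Scope ring_scope.

(** A second-order estimate of the power, obtained from the inequality of
Bernoulli. *)
Lemma expr_le_mean (R : realType) (e : R) K k : 0 <= e <= 1 -> (k <= K)%N ->
  (1 - e) ^+ k <= 1 - k%:R * e * (1 - K%:R * e).
Proof.
move=> /andP[e0 e1] kK.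
have bern m : 1 - m%:R * e <= (1 - e) ^+ m.
  elim: m => [|m IHm]; first by rewrite expr0 mul0r subr0.
  rewrite exprS -natr1; have m0 : 0 <= m%:R :> R by [].
  have : (1 - e) * (1 - m%:R * e) <= (1 - e) * (1 - e) ^+ m.
    by rewrite ler_wpM2l // subr_ge0.
  apply: le_trans; have : 0 <= m%:R * e * e by rewrite !mulr_ge0.
  by nra.
elim: k kK => [|k IHk] kK; first by rewrite expr0 !mul0r subr0.
rewrite exprSr -natr1; have := IHk (ltnW kK).
have : 1 - K%:R * e <= (1 - e) ^+ k.
  apply: le_trans (bern k); rewrite lerB // ler_wpM2r // ler_nat; exact: ltnW.
move: ((1 - e) ^+ k) (K%:R) (k%:R) => x y z; nra.
Qed.

(** The generating function of [p], truncated at [K] with all remaining mass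
counted at 1, has slope above 1 at the point 1. Hence it lies below the diagonal
somewhere to the left of 1. *)
Lemma subcritical_point (R : realType) (p : nat -> R) K :
  (forall k, 0 <= p k) -> 1 < \sum_(k < K) k%:R * p k ->
  exists2 s, 0 <= s < 1 &
    \sum_(k < K) p k * s ^+ k + (1 - \sum_(k < K) p k) <= s.
Proof.
move=> p0; set M := \sum_(k < K) _ => M1.
have K1 : 1 <= K%:R :> R.
  rewrite ler1n lt0n; apply/eqP => K0; move: M1; rewrite /M K0 big_ord0 ltr10 //.
have M0 : 0 < M by lra.
(* The value at which the bounds of [expr_le_mean], weighted by [p] and summed,
   fall exactly [e] below the sum of [p]. *)
pose e := (M - 1) / (M * K%:R).
have MK : 1 <= M * K%:R by nra.
have e01 : 0 < e <= 1.
  apply/andP; split; first by rewrite divr_gt0 //; nra.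
  rewrite ler_pdivrMr; nra.
have Ke : M * (1 - K%:R * e) = 1.
  rewrite /e; field; apply/andP; split; apply: lt0r_neq0; lra.
exists (1 - e); first by apply/andP; split; lra.
have H : \sum_(k < K) p k * (1 - e) ^+ k <=
    \sum_(k < K) (p k - k%:R * p k * (e * (1 - K%:R * e))).
  apply: ler_sum => k _; have := @expr_le_mean R e K k.
  rewrite (ltnW (ltn_ord k)) => /(_ _ isT) Hk.
  have /Hk : 0 <= e <= 1 by apply/andP; split; lra.
  move=> /(ler_wpM2l (p0 k)); by nra.
have : \sum_(k < K) (p k - k%:R * p k * (e * (1 - K%:R * e))) = \sum_(k < K) p k - e.
  rewrite sumrB -mulr_suml -/M; congr (_ - _).
  by rewrite mulrCA Ke mulr1.
by move: H; lra.
Qed.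

Local Open Scope ereal_scope.

(** The mean is the limit of its truncations, finite or not. *)
Lemma truncated_mean (R : realType) (chi : probability nat R) :
  1 < 'E_chi[fun i : nat => (i%:R)%R] ->
  exists K, (1 < \sum_(k < K) k%:R * fine (chi [set (k : nat)]%classic))%R.
Proof.
move=> E1; apply: contrapT => Hno.
have HK K : (\sum_(k < K) k%:R * fine (chi [set (k : nat)]%classic) <= 1)%R.
  by rewrite leNgt; apply/negP => HK; apply: Hno; exists K.
suff : 'E_chi[fun i : nat => (i%:R)%R] <= 1 by rewrite leNgt E1.
rewrite expectation.unlock.
have -> : [set: nat]%classic = (\bigcup_k [set k])%classic.
  by apply/seteqP; split=> k // _; exists k.
rewrite ge0_integral_bigcup //; last first.
  apply/trivIsetP => i j _ _ ij; apply/seteqP; split=> k //= [-> E].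
  by rewrite E eqxx in ij.
have HE i : \int[chi]_(x in [set i]%classic) (x%:R : R)%:E =
    (i%:R * fine (chi [set i]%classic))%:E.
  rewrite (eq_integral (cst (i%:R : R)%:E)) ?integral_cst //.
    by rewrite EFinM fineK // fin_num_measure.
  by move=> x; rewrite inE /= => ->.
apply: lime_le.
  by apply: is_cvg_nneseries => i _ _; rewrite HE lee_fin mulr_ge0 ?fine_ge0.
apply: nearW => K; rewrite /= big_mkord; under eq_bigr do rewrite HE.
by rewrite sumEFin lee_fin.
Qed.

End Survival.

Section Extinction.
Local Open Scope ereal_scope.
Variables (R : realType) (chi : probability nat R) (mu : probability tree_space R).
Variables (d : measure_display) (Omega : measurableType d).
Variables (P : probability Omega R) (X : node -> {RV P >-> nat}).
Hypothesis iid : iid_family chi X.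
Hypothesis law : forall A : set tree_space, measurable A ->
  mu A = P [set w | A (gw_tree X w)]%classic.

Definition height_lt h : set tree_space :=
  [set T | forall v, nodes T v -> (size v < h)%N]%classic.

Lemma measurable_height_lt h : measurable (height_lt h).
Proof.
have -> : height_lt h =
    (\bigcap_v (if (size v < h)%N then setT else ~` [set T | nodes T v]))%classic.
  apply/seteqP; split=> T HT v; first by move=> _; case: ifP => // vh /HT; rewrite vh.
  by move=> Tv; have := HT v I; case: ifP.
apply: measurable_forall_node => v; case: ifP => _ //.
exact: measurableC (measurable_node v).
Qed.

(** A tree has height below [h.+1] only if its root has at least [K] children, or
[k] children for some [k] below [K], all with branches of height below [h]. By
the branching property the bound [s] is inherited from [h] to [h.+1]. *)
Lemma height_lt_bound (K : nat) (s : R) (h : nat) :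
  (0 <= s)%R ->
  (\sum_(k < K) fine (chi [set (k : nat)]%classic) * s ^+ k +
    (1 - \sum_(k < K) fine (chi [set (k : nat)]%classic)) <= s)%R ->
  mu (height_lt h) <= s%:E.
Proof.
move=> s0 Hs; elim: h => [|h IHh].
  rewrite (_ : height_lt 0 = set0) ?measure0 ?lee_fin //.
  by apply/seteqP; split=> // T /(_ [::] (nodes_root T)).
rewrite (law (measurable_height_lt _)).
pose F k : set Omega := [set w | X [::] w = k /\ forall j, (j < k)%N ->
  height_lt h (gw_subtree X j w)]%classic.
pose G : set Omega := (X [::] @^-1` (~` `I_K))%classic.
have mF k : measurable (F k).
  rewrite (_ : F k =
    (X [::] @^-1` [set k] `&` subtree_event X k (fun=> height_lt h))%classic) //.
  apply: measurableI; first exact: measurable_funPTI.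
  by apply: measurable_subtree_event => _; exact: measurable_height_lt.
have mG : measurable G by exact: measurable_funPTI.
have PF k : P (F k) <= (fine (chi [set k]%classic) * s ^+ k)%:E.
  rewrite (branching iid law k (fun=> measurable_height_lt h)).
  rewrite EFinM fineK ?fin_num_measure //; apply: lee_wpmul2l => //.
  elim: k => [|k IHk]; first by rewrite big_ord0 expr0.
  rewrite big_ord_recr exprSr EFinM; apply: lee_pmul => //.
  by apply: prode_ge0.
have PG : P G = (1 - \sum_(k < K) fine (chi [set (k : nat)]%classic))%R%:E.
  rewrite iid.1 probability_setC // EFinB; congr (_ - _).
  rewrite (_ : `I_K = \big[setU/set0]_(k < K) [set (k : nat)])%classic; last first.
    rewrite -bigcup_mkord; apply/seteqP; split=> k /= kK; first by exists k.
    by case: kK => j /= jK ->.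
  rewrite measure_semi_additive_ord //.
  - by rewrite -sumEFin; apply: eq_bigr => k _; rewrite fineK // fin_num_measure.
  - apply/trivIsetP => i j _ _ ij; apply/seteqP; split=> k //= [-> /val_inj E].
    by rewrite E eqxx in ij.
have sub : ([set w | height_lt h.+1 (gw_tree X w)] `<=`
    (\big[setU/set0]_(k < K) F k) `|` G)%classic.
  move=> w Hw; have [XK|XK] := ltnP (X [::] w) K; last first.
    by right; rewrite /G /= ltnNge XK.
  left; rewrite -bigcup_mkord; exists (X [::] w) => //; split=> // j jX u Hu.
  have := Hw (rcons u j); rewrite size_rcons ltnS; apply.
  by rewrite /gw_tree offspring_tree_graft; apply/graft_rcons.
apply: (@le_trans _ _ (P (\big[setU/set0]_(k < K) F k `|` G)%classic)).
  apply: le_measure => //; rewrite inE.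
    rewrite -[X in measurable X]setTI.
    exact: (measurable_gw_tree X measurableT (measurable_height_lt _)).
  by apply: measurableU => //; apply: bigsetU_measurable.
apply: le_trans (measureU2 _ _ _) _ => //; first exact: bigsetU_measurable.
apply: (@le_trans _ _ (\sum_(k < K) P (F k) + P G)).
  by apply: leeD => //; exact: Boole_inequality.
apply: le_trans
  (_ : (\sum_(k < K) fine (chi [set (k : nat)]%classic) * s ^+ k)%R%:E + P G <= _).
  by apply: leeD => //; rewrite -sumEFin; apply: lee_sum => k _.
by rewrite PG -EFinD lee_fin.
Qed.

Lemma survival : 1 < 'E_chi[fun i : nat => (i%:R)%R] ->
  ~ mu.-negligible [set T | ~ finite_tree T]%classic.
Proof.
move=> /truncated_mean[K MK] Hneg.
have [|s /andP[s0 s1] Hs] :=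
  @subcritical_point R (fun k => fine (chi [set k]%classic)) K _ MK.
  by move=> k; exact: fine_ge0.
have mU : measurable (\bigcup_h height_lt h)%classic.
  by apply: bigcupT_measurable => h; exact: measurable_height_lt.
have HU : mu (\bigcup_h height_lt h)%classic <= s%:E.
  have cv := nondecreasing_cvg_mu (mu := mu) measurable_height_lt mU.
  have {}cv : (mu \o height_lt @ \oo --> mu (\bigcup_h height_lt h))%classic.
    apply: cv => h h' hh'; apply/subsetPset => T HT v /HT; move/leq_trans; exact.
  rewrite -(cvg_lim _ cv) //; apply: lime_le; first by apply/cvg_ex; eexists; exact: cv.
  by apply: nearW => h; exact: height_lt_bound Hs.
have := measurableC mU => mC.
have : mu (~` \bigcup_h height_lt h)%classic = 0.
  apply/negligibleP => //; apply: negligibleS Hneg => T nT /finite_seqP[l El].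
  apply: nT; exists (\max_(v <- l) size v)%N.+1 => // v Tv.
  rewrite ltnS; apply: (@leq_bigmax_seq _ l xpredT (fun v : node => size v)) => //.
  by move: Tv; rewrite El.
rewrite probability_setC // => /eqP; rewrite sube_eq //.
  by rewrite add0e => /eqP E; move: HU; rewrite -E lee_fin leNgt s1.
Qed.

End Extinction.

Theorem mainTheorem1 (R : realType) (chi : probability nat R)
    (mu : probability tree_space R) :
  (forall i : nat, (0 < chi [set i]%classic)%E) ->
  (1 < 'E_chi[fun i : nat => (i%:R)%R])%E ->
  galton_watson_measure chi mu ->
  ~ exists (T0 : set tree) (A : emso),
      [/\ (forall T : tree, T0 T -> ~ finite_tree T),
          mu.-negligible T0,
          (forall T : tree, finite_tree T -> satisfies T A) &
          (forall T : tree, ~ finite_tree T -> ~ T0 T -> ~ satisfies T A)].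
Proof.
move=> chi_gt0 mean_gt1 [d0 [Om [P0 [X0 [iid law]]]]] [T0 [A [_ T0null finA infA]]].
apply: (survival iid law mean_gt1).
exact: (infinite_negligible iid law chi_gt0 T0null finA infA).
Qed.
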